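(* The following statements hold. (1) An instance $(G,\lambda,s,t)$ of Dyck-2 reachability is a yes-instance if and only if there exists a walk scheme for it. (2) There is a deterministic algorithm that runs in time $O(|V|^2)$ and decides, given an instance $(G,\lambda,s,t)$ of Dyck-2 reachability with $G=(V,E)$ and given a context-free grammar, whether the grammar is a walk scheme for that instance.
   Context: Dyck-2 language: the language over the alphabet $\{\texttt{(},\texttt{)},\texttt{[},\texttt{]}\}$ generated by the grammar $S\to SS \mid \texttt{(}\,S\,\texttt{)} \mid \texttt{[}\,S\,\texttt{]} \mid \varepsilon$. Dyck-2 reachability: an instance $(G,\lambda,s,t)$ consists of a finite directed graph $G=(V,E)$, an edge labeling $\lambda\colon E\to\{\texttt{(},\texttt{)},\texttt{[},\texttt{]}\}$ and two vertices $s,t\in V$. A walk from $u$ to $v$ is a sequence of consecutive edges (vertices and edges may repeat) starting at $u$ and ending at $v$; the empty walk from $u$ to $u$ is allowed. A walk is valid if the concatenation of its edge labels is a word of the Dyck-2 language. The instance is a yes-instance if there is a valid walk from $s$ to $t$, and a no-instance otherwise. Walk scheme: let $\overrightarrow{V^2}=\{\overrightarrow{uv} \mid (u,v)\in V^2\}$ be a fresh copy of $V^2$. A walk scheme for $(G,\lambda,s,t)$ is a context-free grammar with set of terminal symbols $E$, a set of nonterminal symbols $\mathsf{NT}\subseteq\overrightarrow{V^2}$, and axiom (start symbol) $\overrightarrow{st}\in\mathsf{NT}$, such that: - for each nonterminal $\overrightarrow{uv}\in\mathsf{NT}$ there is exactly one production with left-hand side $\overrightarrow{uv}$, and it has one of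 the forms (a) $\overrightarrow{uv}\to\overrightarrow{uw}\;\overrightarrow{wv}$ for some $w\in V$; (b) $\overrightarrow{uv}\to e\;\overrightarrow{xy}\;f$ for some edges $e=(u,x)\in E$ and $f=(y,v)\in E$ with $\lambda(e)\lambda(f)\in\{\texttt{()},\texttt{[]}\}$; (c) $\overrightarrow{uu}\to\varepsilon$ for some $u\in V$ (i.e. the left-hand side has $u=v$); - the directed graph with vertex set $\mathsf{NT}$ and edge set $\{(\overrightarrow{ab},\overrightarrow{cd}) \mid \overrightarrow{cd}\text{ occurs on the right-hand side of the production of }\overrightarrow{ab}\}$ is acyclic. Running times are in the RAM model with unit-cost operations on $O(\log n)$-bit words. *)

(* Defs.v *)
From mathcomp Require Import all_boot finmap.

Set Implicit Arguments.
Unset Strict Implicit.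
Unset Printing Implicit Defensive.


(** * The Dyck-2 language *)

Inductive bracket := LPar | RPar | LBra | RBra.

(* One constructor per production of  S -> S S | ( S ) | [ S ] | epsilon. *)
Inductive dyck2 : seq bracket -> Prop :=
| Dyck2_cat v w : dyck2 v -> dyck2 w -> dyck2 (v ++ w)
| Dyck2_par w : dyck2 w -> dyck2 (LPar :: rcons w RPar)
| Dyck2_bra w : dyck2 w -> dyck2 (LBra :: rcons w RBra)
| Dyck2_nil : dyck2 [::].

(** * Dyck-2 reachability *)

(* Vertices are named by elements of [K]; an edge is an ordered pair of
   vertices.  [label] is total on pairs for convenience: its values outside
   [edges] are never used. *)
Record dyck_instance (K : choiceType) := DyckInstance {
  vertices : {fset K};
  edges : {fset K * K};
  label : K * K -> bracket;
  source : K;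
  target : K;
  edges_vertices : (edges `<=` vertices `*` vertices)%fset;
  source_vertex : source \in vertices;
  target_vertex : target \in vertices
}.

Fixpoint is_walk (K : choiceType) (I : dyck_instance K)
    (u : K) (p : seq (K * K)) (v : K) : Prop :=
  match p with
  | [::] => u \in vertices I /\ u = v
  | e :: q => [/\ e \in edges I, e.1 = u & is_walk I e.2 q v]
  end.

Definition yes_instance (K : choiceType) (I : dyck_instance K) : Prop :=
  exists p : seq (K * K),
    is_walk I (source I) p (target I) /\ dyck2 (map (label I) p).

(** * Context-free grammars *)

(* In right-hand sides, [inl] tags nonterminals and [inr] tags terminals. *)
Record cfg (N T : choiceType) := Cfg {
  terminals : {fset T};
  nonterminals : {fset N};
  axiom : N;
  productions : {fset N * seq (N + T)};
  axiom_nonterminal : axiom \in nonterminals;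
  lhs_nonterminal : forall p, p \in productions -> p.1 \in nonterminals;
  rhs_nonterminal : forall p, p \in productions ->
    forall a : N, inl a \in p.2 -> a \in nonterminals;
  rhs_terminal : forall p, p \in productions ->
    forall e : T, inr e \in p.2 -> e \in terminals
}.

(* [b] occurs on the right-hand side of a production of [a]. *)
Definition occurs (N T : choiceType) (g : cfg N T) : rel N :=
  fun a b => has (fun p : N * seq (N + T) => (p.1 == a) && (inl b \in p.2))
                 (productions g).

Definition acyclic (N : choiceType) (r : rel N) : Prop :=
  forall a p, path r a p -> last a p = a -> p = [::].

(** * Walk schemes *)

(* Symbols are named by pairs: the nonterminal [(u, v)] stands for the arrow uv
   and the terminal [(u, v)] for the edge from u to v.  The two copies of the
   pairs are kept apart by the tags [inl] and [inr].  A grammar of this type is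
   otherwise arbitrary: its symbols need not come from an instance. *)
Definition pair_cfg (K : choiceType) : Type := cfg (K * K)%type (K * K)%type.

Inductive walk_production (K : choiceType) (I : dyck_instance K) :
    K * K -> seq ((K * K) + (K * K)) -> Prop :=
| Walk_concat u v w : w \in vertices I ->
    walk_production I (u, v) [:: inl (u, w); inl (w, v)]
| Walk_wrap u v x y : (u, x) \in edges I -> (y, v) \in edges I ->
    [:: label I (u, x); label I (y, v)] = [:: LPar; RPar] \/
    [:: label I (u, x); label I (y, v)] = [:: LBra; RBra] ->
    walk_production I (u, v) [:: inr (u, x); inl (x, y); inr (y, v)]
| Walk_empty u : u \in vertices I ->
    walk_production I (u, u) [::].

Record walk_scheme (K : choiceType) (I : dyck_instance K) (g : pair_cfg K) :
    Prop := WalkScheme {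
  ws_terminals : terminals g = edges I;
  ws_nonterminals : (nonterminals g `<=` vertices I `*` vertices I)%fset;
  ws_axiom : axiom g = (source I, target I);
  ws_unique : forall a, a \in nonterminals g ->
    exists! rhs, (a, rhs) \in productions g;
  ws_form : forall a rhs, (a, rhs) \in productions g -> walk_production I a rhs;
  ws_acyclic : acyclic (occurs g)
}.

(** * The word RAM *)

(* Registers and memory cells hold [w]-bit words; results are taken modulo
   [2 ^ w], [Monus] is truncated subtraction. *)
Inductive instr :=
| Const (r c : nat)       (* r := c *)
| Add (r a b : nat)       (* r := a + b *)
| Monus (r a b : nat)     (* r := a - b *)
| Mul (r a b : nat)       (* r := a * b *)
| Read (r a : nat)        (* r := memory[a] *)
| Write (a r : nat)       (* memory[a] := r *)
| JumpLe (a b l : nat)    (* if a <= b, continue at instruction l *)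
| Halt (answer : bool).

Definition program := seq instr.

Record config := Config {
  pc : nat;
  reg : nat -> nat;
  memory : nat -> nat
}.

Definition upd (f : nat -> nat) (i v : nat) : nat -> nat :=
  fun j => if j == i then v else f j.

Definition exec (w : nat) (i : instr) (c : config) : config :=
  let: Config k R M := c in
  let set r v := Config k.+1 (upd R r (v %% 2 ^ w)) M in
  match i with
  | Const r v => set r v
  | Add r a b => set r (R a + R b)
  | Monus r a b => set r (R a - R b)
  | Mul r a b => set r (R a * R b)
  | Read r a => set r (M (R a))
  | Write a r => Config k.+1 R (upd M (R a) (R r))
  | JumpLe a b l => Config (if R a <= R b then l else k.+1) R M
  | Halt _ => c
  end.

(* [run w P t c = Some b]: started from [c], [P] halts with answer [b] within
   [t] steps.  Leaving the program counts as rejecting. *)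
Fixpoint run (w : nat) (P : program) (t : nat) (c : config) : option bool :=
  match t with
  | 0 => None
  | t'.+1 =>
    match nth (Halt false) P (pc c) with
    | Halt b => Some b
    | i => run w P t' (exec w i c)
    end
  end.

(* The input occupies the memory cells 0, ..., n - 1, register 0 holds its
   length n, and everything else is 0. *)
Definition init (input : seq nat) : config :=
  Config 0 (upd (fun=> 0) 0 (size input)) (fun i => nth 0 input i).

(* Words have O(log n) bits, n being the input length: d times the number of
   bits of n. *)
Definition word_size (d : nat) (input : seq nat) : nat :=
  d * (trunc_log 2 (size input)).+1.

(* Some program decides [Q] in time O(f), inputs being presented through the
   relation [enc].  Word length d * log n is allowed for every sufficiently
   large constant [d], and every encoding whose entries fit into words is
   handled; the program and the constant [C] do not depend on [d]. *)
Definition ram_decidable_in_O (X : Type) (enc : X -> seq nat -> Prop)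
    (Q : X -> Prop) (f : X -> nat) : Prop :=
  exists (P : program) (d0 C : nat),
  forall (d : nat) (x : X) (input : seq nat),
    d0 <= d -> enc x input ->
    all (fun a => a < 2 ^ word_size d input) input ->
    exists b : bool,
      run (word_size d input) P (C * f x) (init input) = Some b /\ (b <-> Q x).

(** * Presenting an instance and a grammar to the RAM *)

Definition bracket_code (l : bracket) : nat :=
  match l with LPar => 1 | RPar => 2 | LBra => 3 | RBra => 4 end.

Definition pair_code (a : nat * nat) : seq nat := [:: a.1; a.2].

Definition symbol_code (z : (nat * nat) + (nat * nat)) : seq nat :=
  match z with
  | inl a => 0 :: pair_code a
  | inr e => 1 :: pair_code e
  end.

Definition production_code
    (p : (nat * nat) * seq ((nat * nat) + (nat * nat))) : seq nat :=
  pair_code p.1 ++ size p.2 :: flatten (map symbol_code p.2).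

Definition list_code (A : Type) (code : A -> seq nat) (s : seq A) : seq nat :=
  size s :: flatten (map code s).

(* The labelled adjacency matrix in row-major order; 0 marks a non-edge. *)
Definition adjacency_code (I : dyck_instance nat) (n : nat) : seq nat :=
  [seq (if (u, v) \in edges I then bracket_code (label I (u, v)) else 0)
     | u <- iota 0 n, v <- iota 0 n].

(* The vertices are numbered 0, ..., |V| - 1.  The three finite sets of the
   grammar are listed without repetition, in an arbitrary order. *)
Definition encodes (x : dyck_instance nat * pair_cfg nat) (input : seq nat) :
    Prop :=
  let I := x.1 in let g := x.2 in
  let n := #|` vertices I| in
  vertices I =i iota 0 n /\
  exists ts ns ps,
    [/\ perm_eq ts (terminals g),
        perm_eq ns (nonterminals g),
        perm_eq ps (productions g) &
        input = [:: n; source I; target I] ++ adjacency_code I n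
                ++ list_code pair_code ts
                ++ list_code pair_code ns
                ++ pair_code (axiom g)
                ++ list_code production_code ps].

(* Main.v *)
Require Import Defs.
From mathcomp Require Import all_boot finmap.
From mathcomp Require Import zify.
Local Open Scope fset_scope.
Local Open Scope nat_scope.

Set Implicit Arguments.
Unset Strict Implicit.
Unset Printing Implicit Defensive.

(* A valid walk yields a walk scheme by induction on its Dyck-2 derivation: the
   productions are added to a list in which right-hand sides only mention
   nonterminals occurring further down, so that the list is acyclic and every
   subwalk with given end points gets a single production.  Conversely, in an
   acyclic grammar well-founded induction gives a valid walk from [u] to [v] for
   every nonterminal [(u, v)].

   For the decision procedure, all three lists of the grammar are rejected at
   once if they are longer than the [n ^ 2] pairs of vertices.  Since they are
   free of repetitions, inclusion and counting replace the comparisons of sets: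
   the terminals are the edges iff they are edges and as numerous, and every
   nonterminal has exactly one production iff the left-hand sides are distinct
   and as many as the nonterminals.  Every node of the occurrence relation has at
   most two successors, so Kahn's algorithm, run on all [n ^ 2] pairs, tests
   acyclicity in time [O(n ^ 2)]. *)

(** A derivation of a valid walk may use the same pair of end points several times, with different
    productions and even nested inside itself. Building the list bottom-up and keeping the first
    production found for each pair removes both defects, so no shortest walk has to be chosen.

    For the algorithm, the obstacle is that the grammar is arbitrary: the input may be far longer
    than [n ^ 2] cells and its numbers as large as a word. So every length, also that of a
    right-hand side, is tested before what follows is read, and a number from the grammar enters an
    address only once it is known to be below [n]. A failing test rejects on the spot, which is
    justified there by refuting [walk_scheme]. No loop is nested in another, so the time bound can
    be read off from the syntax of the program.

    The adjacency matrix alone has [n ^ 2] cells. Hence a fixed number of arrays of that size behind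
    the input have addresses linear in the input length, which fit into words. These cells are [0]
    at the start, so the arrays need no initialization. *)

Lemma uniq_map_inj (T U : eqType) (f : T -> U) s x y :
  uniq (map f s) -> x \in s -> y \in s -> f x = f y -> x = y.
Proof.
elim: s => //= z s IH /andP[zs us]; rewrite !inE.
move=> /predU1P[->|xs] /predU1P[->|ys] fxy //; last exact: IH.
  by rewrite fxy map_f in zs.
by rewrite -fxy map_f in zs.
Qed.

(** * Acyclic relations *)

(** A second visit to the start would close a nonempty cycle. *)
Lemma acyclic_path_uniq (T : choiceType) (r : rel T) a p :
  acyclic r -> path r a p -> uniq (a :: p).
Proof.
move=> acy; elim: p a => [//|b p IH] a rp.
have := rp; rewrite /= => /andP[_ /IH /= ->]; rewrite andbT.
apply/negP => /path.splitPr def_p; move: rp; case: def_p => p1 p2.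
rewrite -cat_rcons cat_path => /andP[/acy rp _].
by have := rp (last_rcons _ _ _); case: (p1).
Qed.

Lemma acyclic_converse (T : choiceType) (r : rel T) :
  acyclic r -> acyclic (fun x y => r y x).
Proof.
move=> acy a p rp la; case/lastP: p rp la => [//|p b] rp.
rewrite last_rcons => eba; subst b.
have := rev_path r a (rcons p a); rewrite last_rcons belast_rcons rp.
move=> /acy; rewrite rev_cons last_rcons => /(_ erefl) /(congr1 size).
by rewrite size_rcons.
Qed.

Lemma acyclic_homo (T U : choiceType) (f : T -> U) (r : rel T) (r' : rel U) :
  (forall x y, r x y -> r' (f x) (f y)) -> acyclic r' -> acyclic r.
Proof.
move=> fr acy a p rp la; have /acy : path r' (f a) (map f p).
  by apply: homo_path rp => x y; apply: fr.
by rewrite last_map la => /(_ erefl); case: (p).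
Qed.

(** Paths are free of repetitions and stay in [s] after their start, so none is longer than [s]; the
    induction is on the length that a path can still gain. *)
Lemma acyclic_ind (T : choiceType) (r : rel T) (s : seq T) (P : T -> Prop) :
  acyclic r -> (forall a b, r a b -> b \in s) ->
  (forall a, (forall b, r a b -> P b) -> P a) -> forall a, P a.
Proof.
move=> acy rs step a.
suff H k x p : path r x p -> size s < size p + k -> P (last x p).
  by apply: (H (size s).+1 a [::]) => //=; rewrite add0n.
elim: k x p => [|k IH] x p rp.
  rewrite addn0 ltnNge; case/negP.
  have /andP[_ up] := acyclic_path_uniq acy rp.
  apply: uniq_leq_size => // y; elim: (p) (x) rp => //= z q IHq w /andP[rwz rq].
  by rewrite inE => /orP[/eqP->|/(IHq _ rq)//]; apply: rs rwz.
move=> lt; apply: step => b rb; rewrite -(last_rcons x p b).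
by apply: IH; rewrite ?rcons_path ?rp // size_rcons; lia.
Qed.

(** * Walk schemes and valid walks *)

Section WalkSchemes.
Variables (K : choiceType) (I : dyck_instance K).

Lemma edge_vertices e : e \in edges I -> e.1 \in vertices I /\ e.2 \in vertices I.
Proof. by case: e => u v /(fsubsetP (edges_vertices I)); rewrite in_fsetM => /andP. Qed.

Lemma walk_cat u w v p q :
  is_walk I u p w -> is_walk I w q v -> is_walk I u (p ++ q) v.
Proof.
elim: p u => [|e p IH] u /=; first by case=> _ ->.
by case=> ? ? /IH H /H.
Qed.

Lemma walk_split u v p q : is_walk I u (p ++ q) v ->
  exists w, is_walk I u p w /\ is_walk I w q v.
Proof.
elim: p u => [|e p IH] u /=.
  move=> wq; exists u; split=> //; split=> //.
  by case: q wq => [[]//|e q [/edge_vertices[? _] <-]].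
by case=> ? ? /IH[w [? ?]]; exists w.
Qed.

Lemma walk_source u v p : is_walk I u p v -> u \in vertices I.
Proof. by case: p => [[]//|e q [/edge_vertices[? _] <-]]. Qed.

Lemma walk_target u v p : is_walk I u p v -> v \in vertices I.
Proof. by elim: p u => [u [? <-]//|e p IH u [_ _ /IH]]. Qed.

Lemma walk_scheme_yes g : walk_scheme I g -> yes_instance I.
Proof.
case=> _ sub ax uni form acy; rewrite /yes_instance.
pose P (a : K * K) := a \in nonterminals g ->
  exists p, is_walk I a.1 p a.2 /\ dyck2 (map (label I) p).
suff H : P (source I, target I) by apply: H; rewrite -ax axiom_nonterminal.
apply: (acyclic_ind (s := nonterminals g) acy).
  by move=> a b /hasP[p pg /andP[_]]; apply: rhs_nonterminal pg _.
move=> a IH ag; have [rhs [rg _]] := uni _ ag.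
have {}IH b : inl b \in rhs ->
  exists p, is_walk I b.1 p b.2 /\ dyck2 (map (label I) p).
  move=> brhs; apply: IH; last exact: rhs_nonterminal rg _ brhs.
  by apply/hasP; exists (a, rhs); rewrite //= eqxx.
case: (form _ _ rg) IH => [u v w wI|u v x y ux yv lab|u uI] IH /=.
- have [p [wp dp]] := IH (u, w) (mem_head _ _).
  have [|q [wq dq]] := IH (w, v); first by rewrite !inE eqxx orbT.
  exists (p ++ q); rewrite map_cat; split; first exact: walk_cat wp wq.
  exact: Dyck2_cat.
- have [|p [wp dp]] := IH (x, y); first by rewrite !inE eqxx orbT.
  exists ((u, x) :: rcons p (y, v)); split.
    split=> //=; rewrite -cats1; apply: walk_cat wp _; split=> //=.
    by have [] := edge_vertices yv.
  by rewrite /= map_rcons; case: lab => [[-> ->]|[-> ->]]; constructor.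
- by exists [::]; split=> //; constructor.
Qed.

(* A list of productions in which right-hand sides only use nonterminals
   defined further down the list: acyclic by construction. *)
Fixpoint stratified (L : seq ((K * K) * seq ((K * K) + (K * K)))) : Prop :=
  match L with
  | [::] => True
  | (a, rhs) :: L' =>
    [/\ a \notin map fst L', a \in vertices I `*` vertices I,
        walk_production I a rhs,
        (forall b, inl b \in rhs -> b \in map fst L') & stratified L']
  end.

Lemma stratified_rhs L a rhs b : stratified L -> (a, rhs) \in L ->
  inl b \in rhs -> b \in map fst L.
Proof.
elim: L => [//|[c rhs'] L IH] /= [_ _ _ sub sL].
by rewrite !inE => /orP[/eqP[_ ->] /sub->|aL /(IH sL aL)->]; rewrite orbT.
Qed.

(** The position in the list is the rank that later excludes cycles. [index] finds first
    occurrences, so distinctness of the left-hand sides enters here. *)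
Lemma stratified_index L a rhs b : stratified L -> (a, rhs) \in L ->
  inl b \in rhs -> index a (map fst L) < index b (map fst L).
Proof.
elim: L => [//|[c rhs'] L IH] /= [cL _ _ sub sL].
rewrite inE => /orP[/eqP[-> ->]|aL] brhs.
  by rewrite eqxx; case: eqP (sub _ brhs) => // <-; rewrite (negPf cL).
have neq d : d \in map fst L -> (c == d) = false.
  by move=> dL; apply: contraNF cL => /eqP->.
rewrite !neq ?(map_f fst aL) ?(stratified_rhs sL aL) // ltnS.
exact: IH.
Qed.

(** If [(u, v)] is already defined, the list stays as it is and the new production is dropped; this
    is what keeps productions unique. *)
Lemma stratified_add L u v rhs : stratified L ->
  u \in vertices I -> v \in vertices I -> walk_production I (u, v) rhs ->
  (forall b, inl b \in rhs -> b \in map fst L) ->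
  exists L', [/\ stratified L', (u, v) \in map fst L'
    & {subset map fst L <= map fst L'}].
Proof.
move=> sL uI vI wp sub; case: (boolP ((u, v) \in map fst L)) => [uvL|uvL].
  by exists L; split.
exists (((u, v), rhs) :: L); split; last by move=> b /=; rewrite inE orbC => ->.
  by split=> //; rewrite in_fsetM uI.
by rewrite /= mem_head.
Qed.

(** The starting list [L] is arbitrary so that, for a concatenation, the list built for one subwalk
    can be extended for the other. *)
Definition stratified_for w := forall u v p L,
  is_walk I u p v -> map (label I) p = w -> stratified L ->
  exists L', [/\ stratified L', (u, v) \in map fst L'
    & {subset map fst L <= map fst L'}].

Lemma stratified_for_wrap o c w :
  [:: o; c] = [:: LPar; RPar] \/ [:: o; c] = [:: LBra; RBra] ->
  stratified_for w -> stratified_for (o :: rcons w c).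
Proof.
move=> oc IH u v [//|[u' x] p] L wp /= [eo].
case/lastP: p wp => [|p [y v']] wp; first by case: (w).
rewrite map_rcons => /rcons_inj[ew ec] sL.
have [/= ux eu] := wp; subst u'; rewrite -cats1 => /walk_split[z [wxz]] [/= yv ez].
subst z; case=> vI ev; subst v'.
have [L1 [sL1 xyL1 sub1]] := IH _ _ _ _ wxz ew sL.
have [||||L2 [sL2 uvL2 sub2]] := stratified_add (u := u) (v := v)
  (rhs := [:: inr (u, x); inl (x, y); inr (y, v)]) sL1.
- by have [] := edge_vertices ux.
- by [].
- by constructor; rewrite ?eo ?ec.
- by move=> b; rewrite !inE => /or3P[]// /eqP[->].
by exists L2; split=> // b /sub1/sub2.
Qed.

Lemma dyck2_stratified w : dyck2 w -> stratified_for w.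
Proof.
elim=> {w} [w1 w2 _ IH1 _ IH2 u v p L|w _|w _|].
- move=> wp e sL.
  have ep : map (label I) (take (size w1) p) = w1 by rewrite map_take e take_size_cat.
  have eq : map (label I) (drop (size w1) p) = w2 by rewrite map_drop e drop_size_cat.
  move: wp; rewrite -{1}(cat_take_drop (size w1) p).
  move=> /walk_split[x [wp wq]].
  have [L1 [sL1 uxL1 sub1]] := IH1 _ _ _ _ wp ep sL.
  have [L2 [sL2 xvL2 sub2]] := IH2 _ _ _ _ wq eq sL1.
  have [||||L3 [sL3 uvL3 sub3]] := stratified_add (u := u) (v := v)
    (rhs := [:: inl (u, x); inl (x, v)]) sL2.
  + exact: walk_source wp.
  + exact: walk_target wq.
  + by constructor; apply: walk_target wp.
  + by move=> b; rewrite !inE => /orP[] /eqP[->] //; apply: sub2.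
  by exists L3; split=> // b /sub1/sub2/sub3.
- by apply: stratified_for_wrap; left.
- by apply: stratified_for_wrap; right.
- move=> u v [|//] L [uI <-] _ sL.
  by apply: (stratified_add (rhs := [::]) sL) => //; constructor.
Qed.

Lemma stratified_grammar L : (source I, target I) \in map fst L ->
  stratified L -> exists g : pair_cfg K, walk_scheme I g.
Proof.
move=> stL sL.
have lhsV a rhs : (a, rhs) \in L -> a \in vertices I `*` vertices I.
  elim: L sL {stL} => [//|[c rhs'] L IH] /= [_ ? _ _ sL].
  by rewrite inE => /orP[/eqP[-> _]|/(IH sL)].
have form a rhs : (a, rhs) \in L -> walk_production I a rhs.
  elim: L sL {stL lhsV} => [//|[c rhs'] L IH] /= [_ _ ? _ sL].
  by rewrite inE => /orP[/eqP[-> ->]|/(IH sL)].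
have uL : uniq (map fst L).
  by elim: L sL {stL lhsV form} => [//|[c rhs'] L IH] /= [-> _ _ _ /IH].
pose nt := [fset a in map fst L]; pose ps := [fset p in L].
have ntE a : (a \in nt) = (a \in map fst L) by rewrite !inE.
have psE p : (p \in ps) = (p \in L) by rewrite !inE.
have ax : (source I, target I) \in nt by rewrite ntE.
have Hl p : p \in ps -> p.1 \in nt by rewrite psE ntE => /(map_f fst).
have Hn p : p \in ps -> forall a, inl a \in p.2 -> a \in nt.
  by case: p => a rhs; rewrite psE => pL b; rewrite ntE; apply: stratified_rhs pL.
have Ht p : p \in ps -> forall e, inr e \in p.2 -> e \in edges I.
  case: p => a rhs; rewrite psE => /form[u v w _ e|u v x y ux yv _ e|u _ e //].
    by rewrite !inE.
  by rewrite !inE => /or3P[]// /eqP[->].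
exists (Cfg ax Hl Hn Ht); split=> //=.
- apply/fsubsetP => a; rewrite ntE => /mapP[[c rhs] /lhsV cV ->] //.
- move=> a; rewrite ntE => /mapP[[c rhs] pL ->]; exists rhs; split.
    by rewrite psE.
  move=> rhs'; rewrite psE => pL'.
  by have [] := uniq_map_inj uL pL pL' erefl.
- by move=> a rhs; rewrite psE; apply: form.
(* Acyclicity is pulled back from [<] along the position in the list. *)
- apply: (acyclic_homo (f := index^~ (map fst L)) (r' := ltn)).
    move=> a b /hasP[[c rhs] /= cL /andP[/eqP<- bc]].
    by apply: stratified_index bc => //; rewrite -psE.
  move=> a [//|b p] /= /andP[ab]; rewrite path_sortedE; last exact: ltn_trans.
  move=> /andP[/allP bp _] la; have := mem_last b p.
  by rewrite la inE => /orP[/eqP|/bp /=]; lia.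
Qed.

Lemma yes_instanceP : yes_instance I <-> exists g : pair_cfg K, walk_scheme I g.
Proof.
split=> [[p [wp dp]]|[g]]; last exact: walk_scheme_yes.
have [] := dyck2_stratified dp (L := [::]) wp erefl => // L [sL stL _].
exact: stratified_grammar stL sL.
Qed.
End WalkSchemes.

(** * Structured programs for the RAM *)

(* The variable [v] lives in register [9 + v]; the registers below hold the
   input length (0), the input pointer (1), the constant 1 (2), a temporary (3)
   and the base addresses of five scratch arrays (4 to 8). *)
Inductive cmd :=
| Raw (l : seq instr)
| Seq (c1 c2 : cmd)
| IfLe (a b : nat) (c1 c2 : cmd)
| WhileLt (a b : nat) (c : cmd)
| Stop (b : bool).

Fixpoint len (c : cmd) : nat :=
  match c with
  | Raw l => size l
  | Seq c1 c2 => len c1 + len c2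
  | IfLe _ _ c1 c2 => (len c2 + len c1).+2
  | WhileLt _ _ c => (len c).+2
  | Stop _ => 1
  end.

(** Jump targets are absolute, hence the offset [o] of the first instruction. [JumpLe 0 0] compares
    a register with itself and serves as an unconditional jump. *)
Fixpoint compile (o : nat) (c : cmd) : program :=
  match c with
  | Raw l => l
  | Seq c1 c2 => compile o c1 ++ compile (o + len c1) c2
  | IfLe a b c1 c2 =>
      (JumpLe (9 + a) (9 + b) (o.+1 + len c2).+1 :: compile o.+1 c2)
      ++ JumpLe 0 0 ((o.+1 + len c2).+1 + len c1) :: compile (o.+1 + len c2).+1 c1
  | WhileLt a b c =>
      (JumpLe (9 + b) (9 + a) (o.+1 + len c).+1 :: compile o.+1 c)
      ++ [:: JumpLe 0 0 o]
  | Stop b => [:: Halt b]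
  end.

(* A bound on the running time when every loop makes at most [m] rounds. *)
Fixpoint cost (m : nat) (c : cmd) : nat :=
  match c with
  | Raw l => size l
  | Seq c1 c2 => cost m c1 + cost m c2
  | IfLe _ _ c1 c2 => (cost m c1 + cost m c2).+2
  | WhileLt _ _ c => (m * (cost m c).+2).+1
  | Stop _ => 1
  end.

Lemma size_compile c o : size (compile o c) = len c.
Proof.
elim: c o => //= [c1 IH1 c2 IH2|a b c1 IH1 c2 IH2|a b c IH] o.
- by rewrite size_cat IH1 IH2.
- by rewrite size_cat /= IH1 IH2 addnS.
- by rewrite size_cat /= IH addn1.
Qed.

Definition cst v c := Raw [:: Const (9 + v) c].
Definition add v a b := Raw [:: Add (9 + v) (9 + a) (9 + b)].
Definition sub v a b := Raw [:: Monus (9 + v) (9 + a) (9 + b)].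
Definition mul v a b := Raw [:: Mul (9 + v) (9 + a) (9 + b)].
Definition next v := Raw [:: Read (9 + v) 1; Add 1 1 2].
Definition load v j i := Raw [:: Add 3 (4 + j) (9 + i); Read (9 + v) 3].
Definition store j i v := Raw [:: Add 3 (4 + j) (9 + i); Write 3 (9 + v)].
(* Variable 4 holds the number of vertices, variable 3 the constant 3. *)
Definition idx v a b := Raw [:: Mul 3 (9 + a) (9 + 4); Add (9 + v) 3 (9 + b)].
Definition adj v a b :=
  Raw [:: Mul 3 (9 + a) (9 + 4); Add 3 3 (9 + b); Add 3 3 (9 + 3); Read (9 + v) 3].
Definition skip := Raw [::].
Definition require_le a b := IfLe a b skip (Stop false).
Definition require_lt a b := IfLe b a (Stop false) skip.
Definition require_eq a b := Seq (require_le a b) (require_le b a).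

Definition code_at (P : program) (o : nat) (l : program) : Prop :=
  forall i, i < size l -> nth (Halt false) P (o + i) = nth (Halt false) l i.

Lemma code_at_cat P o l1 l2 : code_at P o (l1 ++ l2) ->
  code_at P o l1 /\ code_at P (o + size l1) l2.
Proof.
move=> H; split=> i ilt.
  by rewrite H ?nth_cat ?ilt // size_cat ltn_addr.
by rewrite -addnA H ?size_cat ?ltn_add2l // nth_cat ltnNge leq_addr /= addKn.
Qed.

Lemma code_at_cons P o i l : code_at P o (i :: l) ->
  nth (Halt false) P o = i /\ code_at P o.+1 l.
Proof.
rewrite -cat1s => /code_at_cat[/(_ 0 isT)/=]; rewrite addn0 => -> H; split=> //.
by rewrite -addn1.
Qed.

(** Uniqueness of quotient and remainder: it keeps the scratch arrays disjoint and makes the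
    numbering of pairs injective. *)
Lemma divmod_inj k a b a' b' : b < k -> b' < k ->
  a * k + b = a' * k + b' -> a = a' /\ b = b'.
Proof.
move=> bk b'k e; have k0 : 0 < k by lia.
have := congr1 (divn^~ k) e; rewrite /= !divnMDl // !divn_small // !addn0 => ea.
by split=> //; subst a'; lia.
Qed.

Definition upd2 (A : nat -> nat -> nat) (j i x : nat) : nat -> nat -> nat :=
  fun j' i' => if (j' == j) && (i' == i) then x else A j' i'.

(** * A weakest-precondition calculus with time bounds *)

Section ProgramLogic.
Variables (w : nat) (input : seq nat) (n : nat) (answer : Prop).
Notation W := (2 ^ w).
Notation N := (size input).
Notation m := (n * n).

(* [answer] is the proposition that the program has to decide. *)
Definition good (P : program) (t : nat) (c : config) : Prop :=
  exists b : bool, run w P t c = Some b /\ (b <-> answer).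

Lemma goodS P t c : good P t c -> good P t.+1 c.
Proof.
case=> b [rb ab]; exists b; split=> {ab}//.
elim: t c rb => [//|t IH] c; rewrite [run _ _ t.+1 _]/= [run _ _ t.+2 _]/=.
by case: (nth _ _ _) => [r x|r x y|r x y|r x y|r x|x r|x y l|b'] //; apply: IH.
Qed.

Lemma good_mono P t t' c : t <= t' -> good P t c -> good P t' c.
Proof. by move=> /subnK <-; elim: (t' - t) => // k IH /IH /goodS. Qed.

Definition halting i := if i is Halt _ then true else false.

Lemma good_step P t o R M i : nth (Halt false) P o = i -> ~~ halting i ->
  good P t (exec w i (Config o R M)) -> good P t.+1 (Config o R M).
Proof. by move=> Po hi [b [rb ab]]; exists b; split=> //=; rewrite Po; case: i hi {Po} rb. Qed.

Definition straight i := match i with JumpLe _ _ _ | Halt _ => false | _ => true end.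

Definition execs := foldl (fun c i => exec w i c).

(** Straight-line code never inspects the program counter, so its effect on registers and memory may
    be computed from any starting counter [k]. *)
Lemma execs_pc l k o R M : all straight l ->
  execs (Config o R M) l = Config (o + size l)
    (reg (execs (Config k R M) l)) (memory (execs (Config k R M) l)).
Proof.
elim: l k o R M => [|i l IH] k o R M /=; first by rewrite addn0.
by rewrite -addSnnS; case: i => //= *; exact: IH.
Qed.

Lemma good_raw l P o t R M : code_at P o l -> all straight l ->
  good P t (execs (Config o R M) l) -> good P (size l + t) (Config o R M).
Proof.
elim: l o R M => [//|i l IH] o R M /code_at_cons[Po Pl] /= /andP[si sl] H.
apply: (good_step (i := i)); rewrite ?Po //; first by case: (i) si.
by case: i si {Po} H => //= *; exact: IH.
Qed.

(** The machine state [R], [M] is abstracted to variables [V], unread input [s] and scratch arrays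
    [A]. All addresses in use are below [N + 5 * m <= 6 * N], so [rep_large] keeps address
    computations from wrapping around. *)
Record rep (R M V : nat -> nat) (s : seq nat) (A : nat -> nat -> nat) : Prop := Rep {
  rep_ptr : drop (R 1) input = s;
  rep_one : R 2 = 1;
  rep_base : forall j, j < 5 -> R (4 + j) = N + j * m;
  rep_var : forall v, R (9 + v) = V v;
  rep_input : forall x, x < N -> M x = nth 0 input x;
  rep_array : forall j i, j < 5 -> i < m -> M (N + j * m + i) = A j i;
  rep_reg_small : forall r, R r < W;
  rep_mem_small : forall x, M x < W;
  rep_large : 8 * N.+1 <= W /\ m + 3 <= N }.

Definition vpred := (nat -> nat) -> seq nat -> (nat -> nat -> nat) -> Prop.

(* Weakest precondition in continuation-passing style: [Q] is only required to
   hold if [c] runs to its end, while a [Stop] inside [c] has to be correct. *)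
Definition wp (c : cmd) (Q : vpred) : vpred := fun V s A =>
  forall P o t R M, code_at P o (compile o c) -> rep R M V s A ->
  (forall R' M' V' s' A', rep R' M' V' s' A' -> Q V' s' A' ->
     good P t (Config (o + len c) R' M')) ->
  good P (cost m c + t) (Config o R M).

Lemma wp_mono c (Q Q' : vpred) V s A : wp c Q V s A ->
  (forall V s A, Q V s A -> Q' V s A) -> wp c Q' V s A.
Proof.
move=> H QQ P o t R M Pc rp K; apply: H Pc rp _ => R' M' V' s' A' rp' /QQ.
exact: K.
Qed.

Lemma wp_seq c1 c2 Q V s A : wp c1 (wp c2 Q) V s A -> wp (Seq c1 c2) Q V s A.
Proof.
move=> H P o t R M /= /code_at_cat[Pc1]; rewrite size_compile => Pc2 rp K.
rewrite -addnA; apply: (H) Pc1 rp _ => R' M' V' s' A' rp' H2.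
by apply: H2 Pc2 rp' _ => *; rewrite -addnA; apply: K; eauto.
Qed.

Lemma wp_raw l Q V s A : all straight l ->
  (forall R M, rep R M V s A -> exists V' s' A',
     rep (reg (execs (Config 0 R M) l)) (memory (execs (Config 0 R M) l)) V' s' A'
     /\ Q V' s' A') -> wp (Raw l) Q V s A.
Proof.
move=> sl H P o t R M Pl rp K /=; apply: (good_raw Pl sl).
rewrite (execs_pc 0 _ _ _ sl); have [V' [s' [A' [rp' q]]]] := H _ _ rp.
by apply: K q.
Qed.

Lemma wp_skip (Q : vpred) V s A : Q V s A -> wp skip Q V s A.
Proof. by move=> q; apply: wp_raw => // R M rp; exists V, s, A. Qed.

Lemma wp_stop (b : bool) Q V s A : (b <-> answer) -> wp (Stop b) Q V s A.
Proof.
move=> ba P o t R M /code_at_cons[Po _] _ _; exists b; split=> //=.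
by rewrite Po.
Qed.

Lemma wp_if a b c1 c2 Q V s A :
  (V a <= V b -> wp c1 Q V s A) -> (V b < V a -> wp c2 Q V s A) ->
  wp (IfLe a b c1 c2) Q V s A.
Proof.
move=> H1 H2 P o t R M /= /(code_at_cat (l1 := _ :: _))[].
move=> /code_at_cons[Po Pc2]; rewrite /= size_compile -addSnnS => /code_at_cons[Pj Pc1].
move=> rp K; rewrite addSn; apply: (good_step Po) => //=.
rewrite (rep_var rp) (rep_var rp); case: leqP => [/H1|/H2] {H1 H2}H.
  apply: (@good_mono _ (cost m c1 + t)); first lia.
  apply: H Pc1 rp _ => R' M' V' s' A' rp' q.
  have := K _ _ _ _ _ rp' q; congr (good _ _ (Config _ _ _)); lia.
apply: (@good_mono _ (cost m c2 + t.+1)); first lia.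
apply: H Pc2 rp _ => R' M' V' s' A' rp' q.
apply: (good_step Pj) => //=.
have := K _ _ _ _ _ rp' q; congr (good _ _ (Config _ _ _)); rewrite leqnn; lia.
Qed.

Lemma wp_require_le a b (Q : vpred) V s A : (V b < V a -> ~ answer) ->
  (V a <= V b -> Q V s A) -> wp (require_le a b) Q V s A.
Proof.
move=> H1 H2; apply: wp_if => [/H2|/H1]; first exact: wp_skip.
by move=> nans; apply: wp_stop; split.
Qed.

Lemma wp_require_lt a b (Q : vpred) V s A : (V b <= V a -> ~ answer) ->
  (V a < V b -> Q V s A) -> wp (require_lt a b) Q V s A.
Proof.
move=> H1 H2; apply: wp_if => [/H1|/H2]; last exact: wp_skip.
by move=> nans; apply: wp_stop; split.
Qed.

Lemma wp_require_eq a b (Q : vpred) V s A : (V a <> V b -> ~ answer) ->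
  (V a = V b -> Q V s A) -> wp (require_eq a b) Q V s A.
Proof.
move=> H1 H2; apply/wp_seq/wp_require_le => [lt|le]; first by apply: H1; lia.
by apply/wp_require_le => lt; [apply: H1|apply: H2]; lia.
Qed.

(** Only counting loops occur: the invariant at index [i] forces the counter to be [i] and the bound
    to be [k]. So a loop that is not stopped makes exactly [k] rounds, and [cost] pays for [m >= k]
    of them. *)
Lemma wp_while a b c (Inv : nat -> vpred) k (Q : vpred) V s A : k <= m ->
  (forall i V s A, Inv i V s A -> V a = i /\ V b = k) ->
  (forall i V s A, i < k -> Inv i V s A -> wp c (Inv i.+1) V s A) ->
  (forall V s A, Inv k V s A -> Q V s A) ->
  Inv 0 V s A -> wp (WhileLt a b c) Q V s A.
Proof.
move=> km Iab Ic IQ I0 P o t R M /= /(code_at_cat (l1 := _ :: _))[].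
move=> /code_at_cons[Po Pc]; rewrite /= size_compile -addSnnS => /code_at_cons[Pj _].
move=> rp K; apply: (@good_mono _ (k * (cost m c).+2 + t.+1)).
  by rewrite addnS ltnS leq_add2r leq_mul2r km orbT.
suff main d i : i + d = k -> forall V s A R M, Inv i V s A -> rep R M V s A ->
    good P (d * (cost m c).+2 + t.+1) (Config o R M) by exact: main _ _ _ _ _ I0 rp.
elim: d i => [|d IH] i ik {I0 rp} {}V {}s {}A {}R {}M Ii rp.
  have [Va Vb] := Iab _ _ _ _ Ii; apply: (good_step Po) => //=.
  have ei : i = k by lia.
  rewrite !(rep_var rp) Va Vb ei leqnn.
  have := K _ _ _ _ _ rp; rewrite addnS addnS addSn; apply.
  by apply: IQ; rewrite -ei.
have [Va Vb] := Iab _ _ _ _ Ii; rewrite mulSn -addnA; apply: (good_step Po) => //=.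
have ik' : i < k by lia.
rewrite !(rep_var rp) Va Vb leqNgt ik' /=.
rewrite -[X in good P X _]/((cost m c).+1 + (d * (cost m c).+2 + t.+1)) addSnnS.
apply: (Ic _ _ _ _ ik' Ii) Pc rp _ => R' M' V' s' A' rp' Ii'.
apply: (good_step Pj) => //=; rewrite leqnn.
by apply: (IH i.+1) Ii' rp'; rewrite addSnnS.
Qed.

Lemma rep_set R M V s A v x : rep R M V s A -> x < W ->
  rep (upd R (9 + v) x) M (upd V v x) s A.
Proof.
case=> *; split=> //; rewrite /upd //.
- by move=> j j5; case: eqP => [|_]; [lia|auto].
- by move=> u; rewrite eqn_add2l; case: eqP.
- by move=> r; case: eqP.
Qed.

Lemma rep_tmp R M V s A x : rep R M V s A -> x < W -> rep (upd R 3 x) M V s A.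
Proof. by case=> *; split=> //; rewrite /upd // => r; case: eqP. Qed.

Lemma updE f i x : upd f i x i = x. Proof. by rewrite /upd eqxx. Qed.

Lemma wp_cst v c (Q : vpred) V s A : c <= 8 -> Q (upd V v c) s A ->
  wp (cst v c) Q V s A.
Proof.
move=> c8 q; apply: wp_raw => // R M rp.
have [W_large N_large] := rep_large rp; exists (upd V v c), s, A; split=> //.
by rewrite /= modn_small; [apply: (rep_set _ rp)|]; lia.
Qed.

(** By [rep_large], [8 * m] is below [2 ^ w], so the reduction modulo [2 ^ w] has no effect. *)
Lemma wp_add v a b (Q : vpred) V s A : V a + V b <= 8 * m ->
  Q (upd V v (V a + V b)) s A -> wp (add v a b) Q V s A.
Proof.
move=> le q; apply: wp_raw => // R M rp.
have [W_large N_large] := rep_large rp; exists (upd V v (V a + V b)), s, A; split=> //.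
by rewrite /= !(rep_var rp) modn_small; [apply: (rep_set _ rp)|]; lia.
Qed.

Lemma wp_mul v a b (Q : vpred) V s A : V a * V b <= 8 * m ->
  Q (upd V v (V a * V b)) s A -> wp (mul v a b) Q V s A.
Proof.
move=> le q; apply: wp_raw => // R M rp.
have [W_large N_large] := rep_large rp; exists (upd V v (V a * V b)), s, A; split=> //.
by rewrite /= !(rep_var rp) modn_small; [apply: (rep_set _ rp)|]; lia.
Qed.

Lemma wp_sub v a b (Q : vpred) V s A :
  Q (upd V v (V a - V b)) s A -> wp (sub v a b) Q V s A.
Proof.
move=> q; apply: wp_raw => // R M rp.
have [W_large N_large] := rep_large rp; exists (upd V v (V a - V b)), s, A; split=> //.
have := rep_reg_small rp (9 + a); rewrite /= !(rep_var rp) => lt.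
by rewrite modn_small; [apply: (rep_set _ rp)|]; lia.
Qed.

Lemma wp_next v x s' (Q : vpred) V A : Q (upd V v x) s' A ->
  wp (next v) Q V (x :: s') A.
Proof.
move=> q; apply: wp_raw => // R M rp.
have [W_large N_large] := rep_large rp; exists (upd V v x), s', A; split=> //=.
have ptr := rep_ptr rp.
(* Unread input remains, so the pointer is still inside the input, and its increment cannot
   overflow. *)
have lt : R 1 < N by case: leqP ptr => // /drop_oversize->.
move: ptr; rewrite (drop_nth 0) // => -[ex es].
rewrite modn_small ?(rep_mem_small rp) // (rep_input rp) // ex.
have xW : x < W by rewrite -ex -(rep_input rp) // (rep_mem_small rp).
have := rep_set v rp xW; set R' := upd _ _ _ => rp'.
have -> : R' 1 = R 1 by rewrite /R' /upd.
rewrite (rep_one rp') addn1 modn_small; last lia.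
case: rp' => *; split=> //; rewrite /upd //.
by move=> r; case: eqP => //; lia.
Qed.

Lemma wp_load v j i (Q : vpred) V s A : j < 5 -> V i < m ->
  Q (upd V v (A j (V i))) s A -> wp (load v j i) Q V s A.
Proof.
move=> j5 im q; apply: wp_raw => // R M rp.
have [W_large N_large] := rep_large rp; exists (upd V v (A j (V i))), s, A; split=> //=.
rewrite !(rep_var rp) (rep_base rp) // modn_small; last nia.
rewrite updE (rep_array rp) // modn_small; last first.
  by rewrite -(rep_array rp) // (rep_mem_small rp).
apply: rep_set; last by rewrite -(rep_array rp) // (rep_mem_small rp).
by apply: rep_tmp => //; nia.
Qed.

Lemma wp_store j i v (Q : vpred) V s A : j < 5 -> V i < m ->
  Q V s (upd2 A j (V i) (V v)) -> wp (store j i v) Q V s A.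
Proof.
move=> j5 im q; apply: wp_raw => // R M rp.
have [W_large N_large] := rep_large rp; exists V, s, (upd2 A j (V i) (V v)); split=> //=.
rewrite !(rep_var rp) (rep_base rp) // modn_small; last nia.
have := rep_tmp (x := N + j * m + V i) rp _; case; first nia.
move=> *; split=> //; rewrite /upd /upd2 //=.
- by move=> x xN; case: eqP => [|_]; [lia|exact: rep_input rp _ xN].
- move=> j' i' j'5 i'm; case: eqP => [e|ne].
    have : j' = j /\ i' = V i by apply: (divmod_inj i'm im); lia.
    by case=> -> ->; rewrite !eqxx /= (rep_var rp).
  by case: andP => [[/eqP ej /eqP ei]|_]; [case: ne; rewrite ej ei|exact: (rep_array rp)].
- by move=> x; case: eqP => _; [exact: rep_reg_small rp _|exact: rep_mem_small rp _].
Qed.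

Lemma wp_idx v a b (Q : vpred) V s A : V 4 = n -> V a < n -> V b < n ->
  Q (upd V v (V a * n + V b)) s A -> wp (idx v a b) Q V s A.
Proof.
move=> Vn an bn q; apply: wp_raw => // R M rp.
have [W_large N_large] := rep_large rp; exists (upd V v (V a * n + V b)), s, A; split=> //=.
have lt : V a * n + V b < m by nia.
rewrite !(rep_var rp) Vn modn_small; last lia.
have rp' := rep_tmp (x := V a * n) rp _; rewrite (rep_var (rp' _)) ?updE; last lia.
by rewrite modn_small; [apply: rep_set; first apply: rp'|]; lia.
Qed.

Lemma wp_adj v a b (Q : vpred) V s A : V 3 = 3 -> V 4 = n -> V a < n -> V b < n ->
  Q (upd V v (nth 0 input (3 + (V a * n + V b)))) s A -> wp (adj v a b) Q V s A.
Proof.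
move=> V3 Vn an bn q; apply: wp_raw => // R M rp.
have [W_large N_large] := rep_large rp; set x := nth _ _ _ in q.
exists (upd V v x), s, A; split=> //=.
have lt : V a * n + V b < m by nia.
rewrite !(rep_var rp) Vn modn_small; last lia.
have rp1 : rep (upd R 3 (V a * n)) M V s A by apply: rep_tmp => //; lia.
rewrite (rep_var rp1) updE modn_small; last lia.
have rp2 : rep (upd (upd R 3 (V a * n)) 3 (V a * n + V b)) M V s A.
  by apply: rep_tmp => //; lia.
rewrite (rep_var rp2) updE V3 [_ + 3]addnC modn_small; last lia.
rewrite updE (rep_input rp); last lia.
have xW : x < W by rewrite /x -(rep_input rp) ?(rep_mem_small rp) //; lia.
by rewrite modn_small //; apply: (rep_set _ _ xW); apply: (rep_tmp rp2); lia.
Qed.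
End ProgramLogic.

(** * Kahn's algorithm *)

Notation "c1 ;; c2" := (Seq c1 c2) (at level 60, right associativity).

Arguments upd f i v j /.

(* The variables 0 to 3 hold the constants 0 to 3. *)
Notation zero := 0 (only parsing).
Notation one := 1 (only parsing).
Notation two := 2 (only parsing).
Notation three := 3 (only parsing).
Notation vn := 4 (only parsing).
Notation vsrc := 5 (only parsing).
Notation vtgt := 6 (only parsing).
Notation vm := 7 (only parsing).
Notation vi := 10 (only parsing).
Notation vk := 11 (only parsing).
Notation vc := 12 (only parsing).
Notation vu := 13 (only parsing).
Notation vv := 14 (only parsing).
Notation va := 15 (only parsing).
Notation vx := 16 (only parsing).
Notation vd := 17 (only parsing).
Notation vtl := 18 (only parsing).
Notation vl := 19 (only parsing).
Notation vx1 := 20 (only parsing).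
Notation vy1 := 21 (only parsing).
Notation vx2 := 22 (only parsing).
Notation vy2 := 23 (only parsing).
Notation vx3 := 24 (only parsing).
Notation vy3 := 25 (only parsing).
Notation MARK := 0 (only parsing).
Notation SUCC1 := 1 (only parsing).
Notation SUCC2 := 2 (only parsing).
Notation DEG := 3 (only parsing).
Notation QUEUE := 4 (only parsing).

Definition incr v := add v v one.

(** [DEG] collects in-degrees. Successor entries are shifted by one, with [0] for a missing
    successor: hence the test against [one] and the subtraction. *)
Definition bump j :=
  load vx j vi ;;
  IfLe one vx (sub vx vx one ;; load vd DEG vx ;; incr vd ;; store DEG vx vd) skip.

Definition relax j :=
  load vx j va ;;
  IfLe one vx
    (sub vx vx one ;; load vd DEG vx ;; sub vd vd one ;; store DEG vx vd ;;
     IfLe vd zero (store QUEUE vtl vx ;; incr vtl) skip)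
    skip.

Definition count_degrees :=
  cst vi 0 ;; WhileLt vi vm (bump SUCC1 ;; bump SUCC2 ;; incr vi).

Definition init_queue :=
  cst vtl 0 ;; cst vi 0 ;;
  WhileLt vi vm
    (load vx DEG vi ;; IfLe vx zero (store QUEUE vtl vi ;; incr vtl) skip ;; incr vi).

(** Nothing is removed from the queue array: [vi] is the head and [vtl] the tail. Rejection happens
    when the head catches up with the tail before [m] nodes are processed. *)
Definition kahn :=
  cst vi 0 ;;
  WhileLt vi vm
    (require_lt vi vtl ;; load va QUEUE vi ;; relax SUCC1 ;; relax SUCC2 ;; incr vi).

(** * Correctness of Kahn's algorithm *)

Definition on_cycle (T : eqType) (r : rel T) (b : T) : Prop :=
  exists p, [/\ p != [::], path r b p & last b p = b].

(** The cycle is rotated by one step, to start at the node before [b]. *)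
Lemma on_cycle_pred (T : eqType) (r : rel T) b : on_cycle r b ->
  exists2 a, r a b & on_cycle r a.
Proof.
case=> p [p0 rp lp]; case/lastP: p p0 rp lp => // p z _.
rewrite last_rcons rcons_path => /andP[rp rz] ez; subst z.
by exists (last b p) => //; exists (b :: p); rewrite /= rz rp.
Qed.

Lemma acyclic_on_cycle (T : choiceType) (r : rel T) :
  (forall b, ~ on_cycle r b) -> acyclic r.
Proof. by move=> H a [//|c p] rp lp; case: (H a); exists (c :: p). Qed.

Section Kahn.
Variables (w : nat) (input : seq nat) (n src tgt : nat) (answer : Prop).
Notation m := (n * n).

Definition glob (V : nat -> nat) : Prop :=
  forall v, v < 8 -> V v = nth 0 [:: 0; 1; 2; 3; n; src; tgt; m] v.

Lemma glob_upd V v x : 8 <= v -> glob V -> glob (upd V v x).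
Proof. by move=> v8 gV u u8; rewrite /=; case: eqP => [|_]; [lia|exact: gV]. Qed.

Variables f1 f2 : nat -> nat.
Hypotheses (f1m : forall a, a < m -> f1 a <= m) (f2m : forall a, a < m -> f2 a <= m).

(* [f1] and [f2] give the at most two successors of a node: [0] stands for none
   and [b.+1] for [b].  A double edge counts twice. *)
Definition mult a b := count_mem b.+1 [:: f1 a; f2 a].

Definition succ_rel : rel nat := fun a b => (a < m) && (b.+1 \in [:: f1 a; f2 a]).

Hypothesis answer_acyclic : answer -> acyclic succ_rel.

Notation wp := (wp w input n answer).

Lemma wp_bump j (Q : vpred) V s A a : 0 < j < 3 -> glob V -> V vi = a -> a < m ->
  A j a <= m -> (forall b, b < m -> A DEG b < 4 * m) ->
  (forall V' A', glob V' -> V' vi = a ->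
    (forall j' b, j' != DEG -> A' j' b = A j' b) ->
    (forall b, A' DEG b = A DEG b + (A j a == b.+1)) -> Q V' s A') ->
  wp (bump j) Q V s A.
Proof.
move=> j3 gV Vi am ym Dm H.
have [/= V0 V1] := (gV 0 isT, gV 1 isT).
apply: wp_seq; apply: wp_load; rewrite ?Vi //; first lia.
apply: wp_if => /=; rewrite V1 => y1.
  apply: wp_seq; apply: wp_sub; apply: wp_seq; apply: wp_load => //=; rewrite ?V1; first lia.
  apply: wp_seq; apply: wp_add => //=; rewrite V1; first by have := Dm (A j a - 1); lia.
  apply: wp_store => //=; first lia.
  apply: H => [||j' b jb|b]; rewrite /= ?Vi //.
  - by do !apply: glob_upd.
  - by rewrite /upd2 (negPf jb).
  - rewrite /upd2 /=; case: eqP => [->|ne]; first by rewrite subn1 prednK ?eqxx.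
    by case: eqP => e; lia.
apply: wp_skip; apply: H => [||//|b] //; first by apply: glob_upd.
by rewrite (_ : _ == _ = false) ?addn0 //; lia.
Qed.

Lemma sum_mult_small (P : pred nat) k b : \sum_(a < k | P a) mult a b <= 2 * k.
Proof.
apply: leq_trans (_ : \sum_(a < k) 2 <= _).
  by rewrite big_mkcond leq_sum // => a _; case: (P a) => //; apply: count_size.
by rewrite sum_nat_const card_ord mulnC.
Qed.

Definition succs_stored (A : nat -> nat -> nat) : Prop :=
  forall a, a < m -> A SUCC1 a = f1 a /\ A SUCC2 a = f2 a.

Lemma wp_count_degrees (Q : vpred) V s A : glob V -> succs_stored A ->
  (forall b, A DEG b = 0) ->
  (forall V' A', glob V' -> succs_stored A' ->
     (forall b, A' DEG b = \sum_(a < m) mult a b) -> Q V' s A') ->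
  wp count_degrees Q V s A.
Proof.
move=> gV sA D0 HQ; apply: wp_seq; apply: wp_cst => //.
pose Inv i (V : nat -> nat) (s' : seq nat) A := [/\ s' = s, glob V, V vi = i, succs_stored A
  & forall b, A DEG b = \sum_(a < i) mult a b].
apply: (wp_while (Inv := Inv) (k := m)) => //.
- by move=> i V' s' A' [_ gV' -> _ _]; rewrite gV'.
- move=> i V' s' A' im [-> gV' Vi sA' D].
  have [E1 E2] := sA' _ im.
  have Dm k b : \sum_(a < k) mult a b <= 2 * k by apply: (sum_mult_small predT).
  apply: wp_seq; apply: (@wp_bump _ _ _ _ _ i) => //; first by rewrite E1 f1m.
    by move=> b bm; rewrite D; have := Dm i b; lia.
  move=> V1 A1 gV1 Vi1 S1 D1.
  apply: wp_seq; apply: (@wp_bump _ _ _ _ _ i) => //; first by rewrite S1 // E2 f2m.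
    by move=> b bm; rewrite D1 D; have := Dm i b; case: eqP; lia.
  move=> V2 A2 gV2 Vi2 S2 D2.
  apply: wp_add => //=; rewrite Vi2 gV2 //=; first lia.
  split=> //=; rewrite ?addn1 //.
  + by apply: glob_upd.
  + by move=> a am; rewrite !S2 // !S1 //; apply: sA'.
  + move=> b; rewrite D2 D1 D big_ord_recr /= /mult /= E1 S1 // E2; lia.
- by move=> V' s' A' [-> gV' _ sA' D]; apply: HQ.
- by split=> //=; [apply: glob_upd|move=> b; rewrite big_ord0].
Qed.

Definition queued (q : seq nat) (V : nat -> nat) (A : nat -> nat -> nat) : Prop :=
  V vtl = size q /\ forall j, j < size q -> A QUEUE j = nth 0 q j.

Lemma queued_push q V A x : queued q V A ->
  queued (rcons q x) (upd V vtl (V vtl + 1)) (upd2 A QUEUE (V vtl) x).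
Proof.
case=> tl qA; split; first by rewrite /= size_rcons tl addn1.
move=> j; rewrite size_rcons ltnS /upd2 nth_rcons eqxx tl /= => jq.
by case: eqP => [->|ne]; [rewrite ltnn|rewrite ifT ?qA //; lia].
Qed.

Lemma wp_init_queue (Q : vpred) V s A (d : nat -> nat) : glob V -> succs_stored A ->
  (forall b, A DEG b = d b) ->
  (forall V' A', glob V' -> succs_stored A' -> (forall b, A' DEG b = d b) ->
     queued [seq b <- iota 0 m | d b == 0] V' A' -> Q V' s A') ->
  wp init_queue Q V s A.
Proof.
move=> gV sA D0 HQ; apply: wp_seq; apply: wp_cst => //; apply: wp_seq; apply: wp_cst => //.
pose Inv i (V : nat -> nat) (s' : seq nat) A := s' = s /\ [/\ glob V, V vi = i, succs_stored A,
  (forall b, A DEG b = d b) & queued [seq b <- iota 0 i | d b == 0] V A].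
apply: (wp_while (Inv := Inv) (k := m)) => //.
- by move=> i V' s' A' [_ [gV' -> _ _ _]]; rewrite gV'.
- move=> i V' s' A' im [-> [gV' Vi sA' D qA]].
  have [/= E0 E1] := (gV' 0 isT, gV' 1 isT).
  have iota_i : iota 0 i.+1 = rcons (iota 0 i) i by rewrite -addn1 iotaD cats1.
  have [tl _] := qA.
  have tli : V' vtl <= i.
    by rewrite tl size_filter; apply: leq_trans (count_size _ _) _; rewrite size_iota.
  apply: wp_seq; apply: wp_load => //; rewrite Vi // D.
  apply: wp_seq; apply: wp_if => /=; rewrite E0 => di.
    apply: wp_seq; apply: wp_store => //=; first lia.
    apply: wp_add => /=; rewrite E1 /=; first lia.
    apply: wp_add => /=; rewrite E1 Vi /=; first lia.
    split=> //; split=> //; [by do !apply: glob_upd|by rewrite /= addn1|].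
    have -> : [seq b <- iota 0 i.+1 | d b == 0] = rcons [seq b <- iota 0 i | d b == 0] i.
      by rewrite iota_i filter_rcons ifT //; lia.
    exact: (queued_push i qA).
  apply: wp_skip; apply: wp_add => /=; rewrite E1 Vi /=; first lia.
  split=> //; split=> //; [by do !apply: glob_upd|by rewrite /= addn1|].
  by rewrite iota_i filter_rcons ifF //; lia.
- by move=> V' s' A' [-> [gV' _ sA' D qA]]; apply: HQ.
- by split=> //; split=> //; do !apply: glob_upd.
Qed.

(* The first [k] elements of the queue [q] are processed, except that the edges
   to the successors listed in [pending] are still to be removed. *)
Record kahn_inv (k : nat) (pending q : seq nat) V (A : nat -> nat -> nat) : Prop := KahnInv {
  ki_glob : glob V;
  ki_succs : succs_stored A;
  ki_queued : queued q V A;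
  ki_uniq : uniq q;
  ki_small : forall b, b \in q -> b < m;
  ki_deg : forall b, b < m -> A DEG b =
    count_mem b.+1 pending + \sum_(a < m | (a : nat) \notin take k q) mult a b;
  ki_mem : forall b, b < m -> (b \in q) = (A DEG b == 0);
  ki_on_cycle : forall b, b \in q -> ~ on_cycle succ_rel b }.

Lemma uniq_small_size q : uniq q -> (forall b, b \in q -> b < m) -> size q <= m.
Proof.
move=> uq qm; rewrite -(size_iota 0 m); apply: uniq_leq_size => // b /qm.
by rewrite mem_iota.
Qed.

(** A cycle through [b] passes through a predecessor of [b], and the vanishing sum places every
    predecessor in [q]. *)
Lemma no_pred_off_cycle (q : seq nat) b :
  \sum_(a < m | (a : nat) \notin q) mult a b = 0 ->
  (forall a, a \in q -> ~ on_cycle succ_rel a) -> ~ on_cycle succ_rel b.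
Proof.
move=> /eqP; rewrite sum_nat_eq0 => /forallP /= S qc.
move=> /on_cycle_pred[a /andP[am ab]]; apply: qc; apply: contraLR ab => aq.
by have := S (Ordinal am); rewrite aq /= => /eqP/count_memPn.
Qed.

Lemma wp_relax j k y pending q (Q : vpred) V s A : 0 < j < 3 ->
  kahn_inv k (y :: pending) q V A -> k <= size q ->
  V va < m -> V vi = k.-1 -> A j (V va) = y -> y <= m ->
  (forall V' A' q', kahn_inv k pending q' V' A' -> k <= size q' -> V' va = V va ->
    V' vi = k.-1 -> Q V' s A') ->
  wp (relax j) Q V s A.
Proof.
move=> j3 [gV sA qA uq qm D Dq qc] kq am Vi yE ym HQ.
have [/= E0 E1] := (gV 0 isT, gV 1 isT).
apply: wp_seq; apply: wp_load => //; first lia.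
apply: wp_if => /=; rewrite E1 yE => y0; last first.
  apply: wp_skip; apply: (HQ _ _ q) => //; split=> //; first by apply: glob_upd.
  by move=> b bm; rewrite D //= (_ : _ == _ = false) //; lia.
have [b yb bm] : exists2 b, y = b.+1 & b < m by exists y.-1; lia.
subst y; rewrite {}yb in y0 ym D *.
have Db := D b bm; rewrite /= eqxx in Db.
(* The pending edge still counts in [DEG b], so [b] is not queued yet; in particular the queue array
   has room for it. *)
have bq : b \notin q by rewrite Dq // Db.
have qS : size q < m.
  rewrite -[(size q).+1]/(size (b :: q)); apply: uniq_small_size => [|c].
    by rewrite /= bq.
  by rewrite inE => /orP[/eqP->|/qm].
have [tl _] := qA.
have D' c : c < m -> upd2 A DEG b (A DEG b - 1) DEG c = count_mem c.+1 pending
    + \sum_(a < m | (a : nat) \notin take k q) mult a c.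
  move=> cm; rewrite /upd2 /=; case: (c =P b) => [->|ne]; first by rewrite Db; lia.
  by rewrite D //= (_ : _ == _ = false) //; lia.
apply: wp_seq; apply: wp_sub; apply: wp_seq; apply: wp_load => //=; rewrite E1 subn1 //=.
apply: wp_seq; apply: wp_sub; apply: wp_seq; apply: wp_store => //=; rewrite E1.
apply: wp_if => /=; rewrite E0 => db; last first.
  apply: wp_skip; apply: (HQ _ _ q) => //; split=> //; first by do !apply: glob_upd.
  move=> c cm; rewrite Dq // /upd2 /=; case: (c =P b) => [->|//]; apply/eqP/eqP; lia.
apply: wp_seq; apply: wp_store => //=; first lia.
apply: wp_add => /=; rewrite E1; first lia.
apply: (HQ _ _ (rcons q b)) => //; last by rewrite size_rcons; lia.
have tk : take k (rcons q b) = take k q by rewrite -cats1 takel_cat.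
split=> //.
- by do !apply: glob_upd.
- exact: (queued_push b (V := upd _ _ _)).
- by rewrite rcons_uniq bq.
- by move=> c; rewrite mem_rcons inE => /orP[/eqP->|/qm].
- by move=> c cm; rewrite tk -D'.
- move=> c cm; rewrite mem_rcons inE /upd2 /=; case: eqP => [->|_] /=; last exact: Dq.
  by apply/esym/eqP; lia.
- move=> c; rewrite mem_rcons inE => /orP[/eqP->|/qc//].
  (* The new degree of [b] is [0], so both summands in [D'] vanish and no unprocessed node leads to
     [b]. *)
  apply: (no_pred_off_cycle (q := take k q)) => [|a /mem_take/qc//].
  by have := D' b bm; rewrite /upd2 !eqxx /=; lia.
Qed.

Lemma wp_kahn (Q : vpred) V s A : glob V -> succs_stored A ->
  (forall b, A DEG b = \sum_(a < m) mult a b) ->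
  queued [seq b <- iota 0 m | A DEG b == 0] V A ->
  (forall V' A', acyclic succ_rel -> Q V' s A') ->
  wp kahn Q V s A.
Proof.
move=> gV sA D0 qA HQ; apply: wp_seq; apply: wp_cst => //.
pose Inv i (V : nat -> nat) (s' : seq nat) A :=
  s' = s /\ exists q, [/\ kahn_inv i [::] q V A, i <= size q & V vi = i].
apply: (wp_while (Inv := Inv) (k := m)) => //.
- by move=> i V' s' A' [_ [q [/ki_glob gV' _ ->]]]; rewrite gV'.
- move=> i V' s' A' im [-> [q [inv iq Vi]]] {gV sA D0 qA HQ}.
  have [gV sA [tl qA] uq qm D Dq qc] := inv.
  have /= E1 := gV 1 isT.
  apply: wp_seq; apply: wp_require_lt; rewrite Vi tl => lt.
    (* The queue has run dry with at most [i < m] elements, all processed. In an acyclic relation,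
       induction along predecessors would put every node into it: once all predecessors of a node
       are processed, its degree is [0]. *)
    move=> /answer_acyclic/acyclic_converse acy.
    suff /(uniq_leq_size (iota_uniq 0 m)) : {subset iota 0 m <= q}.
      by rewrite size_iota leqNgt (leq_ltn_trans lt im).
    suff H a : a < m -> a \in q by move=> a; rewrite mem_iota => /H.
    move: a; refine (@acyclic_ind _ _ (iota 0 m) (fun a => a < m -> a \in q) acy _ _).
      by move=> x y /andP[ym _]; rewrite mem_iota.
    move=> a IH am.
    rewrite Dq // D // /= sum_nat_eq0; apply/forallP => -[b bm] /=.
    rewrite take_oversize //; apply/implyP => bq; apply/eqP.
    apply/count_memPn; apply: contraNN bq => ab; apply: IH => //.
    by rewrite /succ_rel bm.
  have am : nth 0 q i < m by apply/qm/mem_nth.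
  have [A1 A2] := sA _ am.
  apply: wp_seq; apply: wp_load; rewrite ?Vi //; rewrite qA //.
  (* Node [i] of the queue counts as processed from the start of its round; its terms leave the sum
     and become the two pending edges. *)
  apply: wp_seq; apply: (wp_relax (k := i.+1) (y := f1 (nth 0 q i)) (q := q)
    (pending := [:: f2 (nth 0 q i)])) => //=; last 2 first.
  + exact: f1m.
  + move=> V1 A1' q1 inv1 iq1 Va1 Vi1.
    have [S1 S2] := ki_succs inv1 am.
    apply: wp_seq; apply: (wp_relax (k := i.+1) (y := f2 (nth 0 q i)) (q := q1)
      (pending := [::])) => //=; rewrite ?Va1 //; first exact: f2m.
    move=> V2 A2' q2 inv2 iq2 Va2 Vi2; have gV2 := ki_glob inv2.
    apply: wp_add; rewrite /= Vi2 gV2 //=; first lia.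
    split=> //; exists q2; split=> //=; last by rewrite addn1.
    by case: inv2 => *; split=> //; apply: glob_upd.
  + split=> //; first by apply: glob_upd.
    move=> b bm; rewrite D //= add0n (bigD1 (Ordinal am)) /=; last first.
      by have := take_uniq i.+1 uq; rewrite (take_nth 0) // rcons_uniq => /andP[].
    congr (_ + _); apply: eq_bigl => a.
    by rewrite (take_nth 0) // mem_rcons inE negb_or andbC.
- move=> V' s' A' [-> [q [inv mq _]]]; apply: HQ; apply: acyclic_on_cycle => b cb.
  have [gV' sA' qA' uq qm _ _ qc] := inv.
  (* At least [m] distinct nodes are queued, hence all of them; a node on a cycle has an outgoing
     edge and so is below [m]. *)
  suff bq : b \in q by apply: qc cb.
  have [[|c p] [// _ /= /andP[/andP[bm _] _] _]] := cb.
  have sub : {subset q <= iota 0 m} by move=> c' /qm; rewrite mem_iota.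
  by have [|_ ->] := uniq_min_size uq sub; rewrite ?size_iota ?mem_iota.
- split=> //; exists [seq b <- iota 0 m | A DEG b == 0]; split=> //.
  split=> //.
  + by apply: glob_upd.
  + by rewrite filter_uniq ?iota_uniq.
  + by move=> b; rewrite mem_filter mem_iota => /andP[].
  + by move=> b bm; rewrite take0 D0.
  + by move=> b bm; rewrite mem_filter mem_iota /= add0n bm andbT.
  + move=> b; rewrite mem_filter D0 => /andP[/eqP S _].
    by apply: (no_pred_off_cycle (q := [::])).
Qed.
End Kahn.

(** * Parsing the input *)

Definition setup :=
  cst zero 0 ;; cst one 1 ;; cst two 2 ;; cst three 3 ;;
  next vn ;; next vsrc ;; next vtgt ;; mul vm vn vn.

Definition count_edges :=
  cst vc 0 ;; cst vi 0 ;;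
  WhileLt vi vm (next vx ;; IfLe one vx (incr vc) skip ;; incr vi).

Definition check_terminals :=
  next vk ;; require_eq vk vc ;; cst vi 0 ;;
  WhileLt vi vk
    (next vu ;; next vv ;; require_lt vu vn ;; require_lt vv vn ;;
     adj vx vu vv ;; require_le one vx ;; incr vi).

Definition check_nonterminals :=
  next vc ;; require_le vc vm ;; cst vi 0 ;;
  WhileLt vi vc
    (next vu ;; next vv ;; require_lt vu vn ;; require_lt vv vn ;; incr vi).

Definition check_axiom :=
  next vu ;; next vv ;; require_eq vu vsrc ;; require_eq vv vtgt.

Definition check_concat :=
  next vx ;; require_eq vx zero ;; next vx1 ;; next vy1 ;;
  next vx ;; require_eq vx zero ;; next vx2 ;; next vy2 ;;
  require_eq vx1 vu ;; require_eq vy1 vx2 ;; require_eq vy2 vv ;;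
  idx vx vx1 vy1 ;; incr vx ;; store SUCC1 va vx ;;
  idx vx vx2 vy2 ;; incr vx ;; store SUCC2 va vx.

(* Matching brackets have codes 1, 2 or 3, 4: the second code is the successor
   of the first one, and it is not 3. *)
Definition check_wrap :=
  next vx ;; require_eq vx one ;; next vx1 ;; next vy1 ;;
  next vx ;; require_eq vx zero ;; next vx2 ;; next vy2 ;;
  next vx ;; require_eq vx one ;; next vx3 ;; next vy3 ;;
  require_eq vx1 vu ;; require_eq vy1 vx2 ;; require_eq vy2 vx3 ;; require_eq vy3 vv ;;
  adj vl vx1 vy1 ;; adj vd vx3 vy3 ;; require_le one vl ;; incr vl ;;
  require_eq vd vl ;; IfLe vl two skip (require_lt three vl) ;;
  idx vx vx2 vy2 ;; incr vx ;; store SUCC1 va vx.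

(* Vertices in productions need no range check: they occur in nonterminals, which
   [check_nonterminals] has bounded, or are compared with such vertices. *)
Definition check_production :=
  next vu ;; next vv ;; idx va vu vv ;;
  load vx MARK va ;; require_le vx zero ;; store MARK va one ;;
  next vl ;;
  IfLe vl zero (require_eq vu vv)
    (IfLe vl two (require_eq vl two ;; check_concat)
      (require_eq vl three ;; check_wrap)) ;;
  incr vi.

Definition check_productions :=
  next vk ;; require_eq vk vc ;; cst vi 0 ;; WhileLt vi vk check_production.

Definition checker :=
  setup ;; count_edges ;; check_terminals ;; check_nonterminals ;; check_axiom ;;
  check_productions ;; count_degrees ;; init_queue ;; kahn ;; Stop true.

(** Each round consumes the code of one element. The unread input is thus determined by the elements
    read so far, and [Inv] need not mention it. *)
Lemma wp_scan w input n (answer : Prop) (T : Type) (code : T -> seq nat) iv kv body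
    (l : seq T) rest (Inv : seq T -> (nat -> nat) -> (nat -> nat -> nat) -> Prop)
    (Q : vpred) V A :
  size l <= n * n ->
  (forall done V A, Inv done V A -> V iv = size done /\ V kv = size l) ->
  (forall done x todo V A, l = done ++ x :: todo -> Inv done V A ->
    forall s, wp w input n answer body (fun V' s' A' => s' = s /\ Inv (rcons done x) V' A')
      V (code x ++ s) A) ->
  (forall V A, Inv l V A -> Q V rest A) -> Inv [::] V A ->
  wp w input n answer (WhileLt iv kv body) Q V (flatten (map code l) ++ rest) A.
Proof.
move=> lm Iik Ib IQ I0.
pose J i (V : nat -> nat) s A := exists done todo, [/\ l = done ++ todo, size done = i,
  s = flatten (map code todo) ++ rest & Inv done V A].
apply: (wp_while (Inv := J) (k := size l)) => //.
- by move=> i V' s' A' [done [todo [_ <- _ /Iik[-> ->]]]].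
- move=> i V' s' A' il [done [[|x todo] [el sd -> Id]]].
    by move: il; rewrite el -sd cats0 ltnn.
  rewrite /= -catA; apply: wp_mono (Ib _ _ _ _ _ el Id _) _ => V1 s1 A1 [-> I1].
  by exists (rcons done x), todo; rewrite cat_rcons size_rcons sd.
- move=> V' s' A' [done [[|x todo] [el sd -> Id]]].
    by apply: IQ; rewrite el cats0.
  by move: sd; rewrite el size_cat /=; lia.
- by exists [::], l.
Qed.

(** Inversion by the length of the right-hand side, on which the program branches; it refutes
    [walk_scheme] when a comparison fails. *)
Lemma walk_productionP (K : choiceType) (I : dyck_instance K) a rhs :
  walk_production I a rhs ->
  match rhs with
  | [::] => a.1 = a.2
  | [:: z1; z2] => exists x, z1 = inl (a.1, x) /\ z2 = inl (x, a.2)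
  | [:: z1; z2; z3] => exists x y, [/\ z1 = inr (a.1, x), z2 = inl (x, y), z3 = inr (y, a.2) &
      [/\ (a.1, x) \in edges I, (y, a.2) \in edges I &
      [:: label I (a.1, x); label I (y, a.2)] = [:: LPar; RPar] \/
      [:: label I (a.1, x); label I (y, a.2)] = [:: LBra; RBra]]]
  | _ => False
  end.
Proof.
by case=> [u v x _|u v x y|u] //=; [exists x|exists x, y].
Qed.

Lemma nth_allpairs_iota (T : Type) (x0 : T) (f : nat -> nat -> T) a k n u v :
  u < k -> v < n ->
  nth x0 [seq f u v | u <- iota a k, v <- iota 0 n] (u * n + v) = f (a + u) v.
Proof.
move=> uk vn; elim: k a u uk => [//|k IH] a [|u] uk /=; rewrite nth_cat size_map size_iota.
  by rewrite mul0n vn (nth_map 0) ?size_iota // nth_iota // addn0.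
rewrite mulSn -addnA ltnNge leq_addr /= addKn IH //.
by rewrite addSnnS.
Qed.

(** * Correctness of the checks on the input *)

Section Checker.
Variables (I : dyck_instance nat) (g : pair_cfg nat) (w n : nat).
Variables (ts ns : seq (nat * nat))
  (ps : seq ((nat * nat) * seq ((nat * nat) + (nat * nat)))).
Notation m := (n * n).
Hypotheses (verticesE : vertices I =i iota 0 n).
Hypotheses (tsE : perm_eq ts (terminals g)) (nsE : perm_eq ns (nonterminals g))
  (psE : perm_eq ps (productions g)).

(** The input is cut into nested suffixes, at which the successive checks start. *)
Definition ps_input := list_code production_code ps.
Definition axiom_input := pair_code (axiom g) ++ ps_input.
Definition ns_input := list_code pair_code ns ++ axiom_input.
Definition ts_input := list_code pair_code ts ++ ns_input.
Definition whole_input :=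
  [:: n; source I; target I] ++ adjacency_code I n ++ ts_input.
Notation answer := (walk_scheme I g).
Notation wp := (wp w whole_input n answer).
Notation glob := (glob n (source I) (target I)).

Lemma vertexE u : (u \in vertices I) = (u < n).
Proof. by rewrite verticesE mem_iota. Qed.

Lemma n_gt0 : 0 < n.
Proof. by have := source_vertex I; rewrite vertexE; case: n. Qed.

Lemma edge_small e : e \in edges I -> e.1 < n /\ e.2 < n.
Proof. by move=> /edge_vertices; rewrite !vertexE. Qed.

Definition edge_code e := if e \in edges I then bracket_code (label I e) else 0.

Lemma edge_code_gt0 e : (0 < edge_code e) = (e \in edges I).
Proof. by rewrite /edge_code; case: (e \in _) => //; case: label. Qed.

(** The offset [3] skips the cells for [n], the source and the target. *)
Lemma nth_whole_input u v : u < n -> v < n ->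
  nth 0 whole_input (3 + (u * n + v)) = edge_code (u, v).
Proof.
move=> un vn; rewrite /whole_input nth_cat /= nth_cat.
rewrite addKn size_allpairs !size_iota ifT ?nth_allpairs_iota //.
by apply: (@leq_trans (u.+1 * n)); [rewrite mulSn; lia|rewrite leq_mul2r un orbT].
Qed.

Lemma wp_edge_code v a b (Q : vpred) V s A : glob V -> V a < n -> V b < n ->
  Q (upd V v (edge_code (V a, V b))) s A -> wp (adj v a b) Q V s A.
Proof.
move=> gV an bn q; apply: wp_adj => //; [exact: (gV 3)|exact: (gV 4)|].
by rewrite nth_whole_input.
Qed.

(** Edges are pairs of numbers below [n], so filtering all such pairs by [edges I] lists every edge
    exactly once. *)
Lemma count_edge_codes : count (leq 1) (adjacency_code I n) = #|` edges I|.
Proof.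
pose prs := [seq (u, v) | u <- iota 0 n, v <- iota 0 n].
have -> : adjacency_code I n = map edge_code prs by rewrite map_allpairs.
rewrite count_map (eq_count (a2 := mem (edges I))); last first.
  by move=> e /=; rewrite edge_code_gt0.
rewrite -size_filter; apply/perm_size/uniq_perm; rewrite ?fset_uniq ?filter_uniq //.
  by apply: allpairs_uniq; rewrite ?iota_uniq // => -[a b] [c d].
move=> e; rewrite mem_filter /=; case eI: (e \in edges I) => //=.
by have [e1 e2] := edge_small eI; case: e e1 e2 {eI} => u v u1 v1; rewrite allpairs_f // mem_iota.
Qed.

Lemma wp_setup (Q : vpred) V A :
  (forall V', glob V' -> Q V' (adjacency_code I n ++ ts_input) A) ->
  wp setup Q V whole_input A.
Proof.
move=> HQ; do 4 (apply: wp_seq; apply: wp_cst => //).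
do 3 (apply: wp_seq; apply: wp_next); apply: wp_mul => /=; first by rewrite leq_pmull.
by apply: HQ; do 8 (case=> [//|]).
Qed.

Lemma wp_count_edges (Q : vpred) V A : glob V ->
  (forall V', glob V' -> V' vc = #|` edges I| -> Q V' ts_input A) ->
  wp count_edges Q V (adjacency_code I n ++ ts_input) A.
Proof.
move=> gV HQ; apply: wp_seq; apply: wp_cst => //; apply: wp_seq; apply: wp_cst => //.
have sz : size (adjacency_code I n) = m by rewrite size_allpairs !size_iota.
(* As a list of one-cell codes the matrix has the form that [wp_scan] expects. *)
rewrite -{1}[adjacency_code I n]flatten_seq1.
apply: (wp_scan (Inv := fun done V A' => A' = A /\
  [/\ glob V, V vi = size done & V vc = count (leq 1) done])); rewrite ?sz //.
- by move=> done V' A' [_ [gV' -> _]]; rewrite gV'.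
- move=> done x todo V' A' e [-> [gV' Vi Vc]] s; have /= E1 := gV' 1 isT.
  have dm : size done < m by rewrite -sz e size_cat /=; lia.
  have cd := count_size (leq 1) done.
  apply: wp_seq; apply: wp_next; apply: wp_seq; apply: wp_if => /=; rewrite E1 => x1.
    apply: wp_add; rewrite /= E1 Vc; first lia.
    apply: wp_add; rewrite /= E1 Vi; first lia.
    split=> //; split=> //; split=> //=; rewrite ?size_rcons ?addn1 //.
      by do !apply: glob_upd.
    by rewrite -cats1 count_cat /= x1 addn1.
  apply: wp_skip; apply: wp_add; rewrite /= E1 Vi; first lia.
  split=> //; split=> //; split=> //=; rewrite ?size_rcons ?addn1 //.
    by do !apply: glob_upd.
  by rewrite -cats1 count_cat /= Vc (_ : (0 < x) = false) ?addn0 //; lia.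
- by move=> V' A' [-> [gV' _ Vc]]; apply: HQ; rewrite ?Vc ?count_edge_codes.
- by split=> //; split=> //; do !apply: glob_upd.
Qed.

Lemma terminalsE e : (e \in terminals g) = (e \in ts).
Proof. by rewrite (perm_mem tsE). Qed.

Lemma wp_check_terminals (Q : vpred) V A : glob V -> V vc = #|` edges I| ->
  (forall V', glob V' -> terminals g = edges I -> Q V' ns_input A) ->
  wp check_terminals Q V ts_input A.
Proof.
move=> gV Vc HQ; apply: wp_seq; apply: wp_next.
have sz : size ts = #|` terminals g| by rewrite (perm_size tsE).
apply: wp_seq; apply: wp_require_eq => /=; rewrite Vc => se.
  by move=> [eT _ _ _ _ _]; rewrite -eT sz in se.
apply: wp_seq; apply: wp_cst => //.
have szm : size ts <= m.
  by rewrite se -count_edge_codes; apply: leq_trans (count_size _ _) _;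
     rewrite size_allpairs !size_iota.
have tsI e : answer -> e \in ts -> e \in edges I.
  by move=> [<- _ _ _ _ _]; rewrite terminalsE.
apply: (wp_scan (Inv := fun done V A' => A' = A /\
  [/\ glob V, V vi = size done, V vk = size ts & {subset done <= edges I}])) => //.
- by move=> done V' A' [_ [_ -> ->]].
- move=> done [u v] todo V' A' e [-> [gV' Vi Vk sub]] s.
  have /= E1 := gV' 1 isT; have /= E3 := gV' 3 isT; have /= En := gV' 4 isT.
  have uvts : (u, v) \in ts by rewrite e mem_cat mem_head orbT.
  have dm : size done < m by apply: leq_trans szm; rewrite e size_cat /=; lia.
  do 2 (apply: wp_seq; apply: wp_next).
  apply: wp_seq; apply: wp_require_lt; rewrite /= En => un.
    by move=> /tsI/(_ uvts)/edge_small /=; lia.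
  apply: wp_seq; apply: wp_require_lt; rewrite /= En => vn.
    by move=> /tsI/(_ uvts)/edge_small /=; lia.
  apply: wp_seq; apply: wp_edge_code => //=; first by do !apply: glob_upd.
  apply: wp_seq; apply: wp_require_le; rewrite /= E1 ?edge_code_gt0 => uvI.
    by move=> /tsI/(_ uvts) uvI'; move: uvI; rewrite ltnNge edge_code_gt0 uvI'.
  apply: wp_add; rewrite /= E1 Vi; first lia.
  split=> //; split=> //; split=> //=; rewrite ?size_rcons ?addn1 //.
    by do !apply: glob_upd.
  by move=> e'; rewrite mem_rcons inE => /orP[/eqP->|/sub].
- move=> V' A' [-> [gV' _ _ sub]]; apply: HQ => //; apply/eqP.
  rewrite eqEfcard; apply/andP; split; last by rewrite -sz se.
  by apply/fsubsetP => e; rewrite terminalsE => /sub.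
- by split=> //; split=> //; do !apply: glob_upd.
Qed.

Lemma nonterminalsE a : (a \in nonterminals g) = (a \in ns).
Proof. by rewrite (perm_mem nsE). Qed.

Lemma wp_check_nonterminals (Q : vpred) V A : glob V ->
  (forall V', glob V' -> V' vc = size ns -> size ns <= m ->
    (forall a, a \in ns -> a.1 < n /\ a.2 < n) -> Q V' axiom_input A) ->
  wp check_nonterminals Q V ns_input A.
Proof.
move=> gV HQ; apply: wp_seq; apply: wp_next.
have nsI a : answer -> a \in ns -> a.1 < n /\ a.2 < n.
  case=> _ /fsubsetP sub _ _ _ _; rewrite -nonterminalsE => /sub.
  by rewrite in_fsetM !vertexE => /andP[].
have /= Em := gV 7 isT.
apply: wp_seq; apply: wp_require_le; rewrite /= Em => szm.
  move=> ans; move: szm; rewrite ltnNge => /negP; apply.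
  have -> : m = size [seq (u, v) | u <- iota 0 n, v <- iota 0 n].
    by rewrite size_allpairs !size_iota.
  apply: uniq_leq_size; first by rewrite (perm_uniq nsE) fset_uniq.
  by move=> [u v] /(nsI _ ans)[/= un vn]; rewrite allpairs_f // mem_iota.
apply: wp_seq; apply: wp_cst => //.
apply: (wp_scan (Inv := fun done V A' => A' = A /\
  [/\ glob V, V vi = size done, V vc = size ns
    & forall a, a \in done -> a.1 < n /\ a.2 < n])) => //.
- by move=> done V' A' [_ [_ -> ->]].
- move=> done [u v] todo V' A' e [-> [gV' Vi Vk sub]] s.
  have /= E1 := gV' 1 isT; have /= En := gV' 4 isT.
  have uvns : (u, v) \in ns by rewrite e mem_cat mem_head orbT.
  have dm : size done < m by apply: leq_trans szm; rewrite e size_cat /=; lia.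
  do 2 (apply: wp_seq; apply: wp_next).
  apply: wp_seq; apply: wp_require_lt; rewrite /= En => un.
    by move=> /nsI/(_ uvns) /=; lia.
  apply: wp_seq; apply: wp_require_lt; rewrite /= En => vn.
    by move=> /nsI/(_ uvns) /=; lia.
  apply: wp_add; rewrite /= E1 Vi; first lia.
  split=> //; split=> //; split=> //=; rewrite ?size_rcons ?addn1 //.
    by do !apply: glob_upd.
  by move=> a; rewrite mem_rcons inE => /orP[/eqP->|/sub].
- by move=> V' A' [-> [gV' _ Vc sub]]; apply: HQ.
- by split=> //; split=> //; do !apply: glob_upd.
Qed.

Lemma wp_check_axiom (Q : vpred) V A : glob V -> V vc = size ns ->
  (forall V', glob V' -> V' vc = size ns -> axiom g = (source I, target I) ->
    Q V' ps_input A) ->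
  wp check_axiom Q V axiom_input A.
Proof.
move=> gV Vc HQ; have /= Es := gV 5 isT; have /= Et := gV 6 isT.
do 2 (apply: wp_seq; apply: wp_next).
apply: wp_seq; apply: wp_require_eq; rewrite /= Es => es.
  by move=> [_ _ ax _ _ _]; rewrite ax in es.
apply: wp_require_eq; rewrite /= Et => et.
  by move=> [_ _ ax _ _ _]; rewrite ax in et.
apply: HQ => //; first by do !apply: glob_upd.
by rewrite -es -et; case: (axiom g).
Qed.

(** * Productions and the occurrence relation on numbered pairs *)

Definition pair_index (a : nat * nat) := a.1 * n + a.2.

Lemma pair_index_inj (a b : nat * nat) : a.2 < n -> b.2 < n ->
  pair_index a = pair_index b -> a = b.
Proof.
by case: a b => [u v] [u' v'] vn v'n /(divmod_inj vn v'n)[/= -> ->].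
Qed.

Lemma pair_index_small (a : nat * nat) : a.1 < n -> a.2 < n -> pair_index a < m.
Proof.
move=> un vn; apply: (@leq_trans (a.1.+1 * n)); last by rewrite leq_mul2r un orbT.
by rewrite mulSn /pair_index; lia.
Qed.

Lemma ltn_fits x : x < m -> x + 1 <= 8 * m.
Proof. lia. Qed.

Lemma small_fits x : x <= 4 -> x + 1 <= 8 * m.
Proof. by have := n_gt0; nia. Qed.

Lemma wp_pair_index v a b (Q : vpred) V s A : glob V -> V a < n -> V b < n ->
  Q (upd V v (pair_index (V a, V b))) s A -> wp (idx v a b) Q V s A.
Proof. by move=> gV an bn q; apply: wp_idx => //; exact: (gV 4). Qed.

Definition rhs_nonterminals (rhs : seq ((nat * nat) + (nat * nat))) :=
  pmap (fun z => if z is inl a then Some a else None) rhs.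

Lemma mem_rhs_nonterminals rhs b : (b \in rhs_nonterminals rhs) = (inl b \in rhs).
Proof.
elim: rhs => //= z rhs IH; rewrite inE -IH /rhs_nonterminals /=.
by case: z => [c|c] //=; rewrite inE.
Qed.

Notation production := ((nat * nat) * seq ((nat * nat) + (nat * nat)))%type.

(** Specifies the successor arrays. The indices are shifted by one so that the default [0] of [nth]
    in [productions_inv] is the code of a missing successor. *)
Definition successors (done : seq production) (x : nat) : seq nat :=
  flatten [seq [seq (pair_index b).+1 | b <- rhs_nonterminals p.2]
    | p <- done & pair_index p.1 == x].

Definition lhs_indices (done : seq production) := [seq pair_index p.1 | p <- done].

Lemma successors_rcons done p x : successors (rcons done p) x = successors done x ++
  (if pair_index p.1 == x then [seq (pair_index b).+1 | b <- rhs_nonterminals p.2] else [::]).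
Proof.
rewrite /successors filter_rcons; case: eqP => _; last by rewrite cats0.
by rewrite map_rcons flatten_rcons.
Qed.

Lemma successors_nil done x : x \notin lhs_indices done -> successors done x = [::].
Proof.
move=> xd; rewrite /successors (eq_in_filter (a2 := pred0)) ?filter_pred0 // => p pd /=.
by apply: contraNF xd => /eqP <-; apply: map_f.
Qed.

Record productions_inv (done : seq production) (A : nat -> nat -> nat) : Prop :=
  ProductionsInv {
  pi_form : forall p, p \in done -> walk_production I p.1 p.2;
  pi_uniq : uniq (lhs_indices done);
  pi_mark : forall x, x < m -> A MARK x = (x \in lhs_indices done);
  pi_succ1 : forall x, x < m -> A SUCC1 x = nth 0 (successors done x) 0;
  pi_succ2 : forall x, x < m -> A SUCC2 x = nth 0 (successors done x) 1;
  pi_deg : forall x, A DEG x = 0 }.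

Lemma productions_inv_rcons done (p : production) A A' (x := pair_index p.1)
    (l := [seq (pair_index b).+1 | b <- rhs_nonterminals p.2]) :
  productions_inv done A -> x \notin lhs_indices done -> walk_production I p.1 p.2 ->
  A' MARK x = 1 -> A' SUCC1 x = nth 0 l 0 -> A' SUCC2 x = nth 0 l 1 ->
  (forall j y, y != x -> A' j y = A j y) -> (forall y, A' DEG y = A DEG y) ->
  productions_inv (rcons done p) A'.
Proof.
move=> [form un mark s1 s2 deg] xd wp M1 S1 S2 frame D.
have mem y : y \in lhs_indices (rcons done p) = (y == x) || (y \in lhs_indices done).
  by rewrite /lhs_indices map_rcons mem_rcons inE.
split.
- by move=> q; rewrite mem_rcons inE => /orP[/eqP->|/form].
- by rewrite /lhs_indices map_rcons rcons_uniq xd.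
- move=> y ym; rewrite mem; case: (y =P x) => [->|/eqP yx]; first by rewrite M1.
  by rewrite frame // mark.
- move=> y ym; rewrite successors_rcons -/x eq_sym.
  case: (y =P x) => [->|/eqP yx]; first by rewrite S1 (successors_nil xd).
  by rewrite cats0 frame // s1.
- move=> y ym; rewrite successors_rcons -/x eq_sym.
  case: (y =P x) => [->|/eqP yx]; first by rewrite S2 (successors_nil xd).
  by rewrite cats0 frame // s2.
- by move=> y; rewrite D.
Qed.

Hypothesis ns_small : forall a, a \in ns -> a.1 < n /\ a.2 < n.

Lemma production_small p : p \in ps -> (p.1.1 < n /\ p.1.2 < n) /\
  forall a, inl a \in p.2 -> a.1 < n /\ a.2 < n.
Proof.
rewrite (perm_mem psE) => pg; split.
  by apply: ns_small; rewrite -nonterminalsE (lhs_nonterminal pg).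
by move=> a ap; apply: ns_small; rewrite -nonterminalsE (rhs_nonterminal pg).
Qed.

Lemma answer_form a rhs : (a, rhs) \in ps -> answer -> walk_production I a rhs.
Proof. by rewrite (perm_mem psE) => pg [_ _ _ _ form _]; apply: form. Qed.

Lemma answer_lhs_inj p q : answer -> p \in ps -> q \in ps -> p.1 = q.1 -> p = q.
Proof.
case: p q => [a r] [b r'] [_ _ _ un _ _] /=; rewrite !(perm_mem psE) => pg qg ab.
subst b; have [x [_ xu]] := un _ (lhs_nonterminal pg).
by rewrite -(xu _ pg) -(xu _ qg).
Qed.

(** The state in which the right-hand side of [p] is about to be checked; [A] describes the arrays
    before the mark of [p] is set. *)
Definition production_read (done : seq production) (p : production) V A :=
  [/\ glob V, productions_inv done A, pair_index p.1 \notin lhs_indices done,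
      [/\ V vu = p.1.1, V vv = p.1.2 & V va = pair_index p.1]
    & V vi = size done /\ V vk = size ps].

Definition production_checked (done : seq production) (p : production) V A :=
  [/\ glob V, productions_inv (rcons done p) A & V vi = size done /\ V vk = size ps].

Lemma marked_inv done (p : production) A : productions_inv done A ->
  pair_index p.1 < m -> pair_index p.1 \notin lhs_indices done ->
  A SUCC1 (pair_index p.1) = 0 /\ A SUCC2 (pair_index p.1) = 0.
Proof.
by move=> inv pm pd; rewrite (pi_succ1 inv) ?(pi_succ2 inv) // (successors_nil pd).
Qed.

Lemma wp_check_concat done (u v : nat) z1 z2 (Q : vpred) V s A :
  (u, v, [:: z1; z2]) \in ps ->
  production_read done (u, v, [:: z1; z2]) V A ->
  (forall V' A', production_checked done (u, v, [:: z1; z2]) V' A' -> Q V' s A') ->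
  wp check_concat Q V (symbol_code z1 ++ symbol_code z2 ++ s)
    (upd2 A MARK (pair_index (u, v)) 1).
Proof.
move=> pps [gV inv nd [/= Vu Vv Va] [Vi Vk]] HQ.
have form := answer_form pps; have [[/= un vn] small] := production_small pps.
have /= E0 := gV 0 isT; have /= E1 := gV 1 isT; have /= En := gV 4 isT.
have xm := pair_index_small (a := (u, v)) un vn.
case: z1 pps inv nd HQ form small => [[x1 y1]|[x1 y1]] pps inv nd HQ form small; last first.
  apply: wp_seq; apply: wp_next; apply: wp_seq; apply: wp_require_eq; rewrite /= E0 //.
  by move=> _ /form/walk_productionP[? []].
have /= [x1n y1n] := small _ (mem_head _ _).
apply: wp_seq; apply: wp_next; apply: wp_seq; apply: wp_require_eq; rewrite /= E0 // => _.
do 2 (apply: wp_seq; apply: wp_next).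
case: z2 pps inv nd HQ form small => [[x2 y2]|[x2 y2]] pps inv nd HQ form small; last first.
  apply: wp_seq; apply: wp_next; apply: wp_seq; apply: wp_require_eq; rewrite /= E0 //.
  by move=> _ /form/walk_productionP[? []].
have /= [x2n y2n] : (x2, y2).1 < n /\ (x2, y2).2 < n by apply: small; rewrite !inE eqxx orbT.
apply: wp_seq; apply: wp_next; apply: wp_seq; apply: wp_require_eq; rewrite /= E0 // => _.
do 2 (apply: wp_seq; apply: wp_next).
apply: wp_seq; apply: wp_require_eq; rewrite /= Vu => e1.
  by move=> /form/walk_productionP[? [[? ?] [? ?]]]; subst.
apply: wp_seq; apply: wp_require_eq => /= e2.
  by move=> /form/walk_productionP[? [[? ?] [? ?]]]; subst.
apply: wp_seq; apply: wp_require_eq; rewrite /= Vv => e3.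
  by move=> /form/walk_productionP[? [[? ?] [? ?]]]; subst.
subst x1 x2 y2.
have i1m := pair_index_small (a := (u, y1)) un y1n.
have i2m := pair_index_small (a := (y1, v)) y1n vn.
apply: wp_seq; apply: wp_pair_index => //=; first by do !apply: glob_upd.
apply: wp_seq; apply: wp_add; rewrite /= E1; first exact: ltn_fits.
apply: wp_seq; apply: wp_store => //=; first by rewrite Va.
apply: wp_seq; apply: wp_pair_index => //=; first by do !apply: glob_upd.
apply: wp_seq; apply: wp_add; rewrite /= E1; first exact: ltn_fits.
apply: wp_store => //=; first by rewrite Va.
rewrite Va !addn1.
apply: HQ; split=> //; first by do !apply: glob_upd.
apply: (productions_inv_rcons inv nd) => //=.
- by constructor; rewrite vertexE.
- by rewrite /upd2 !eqxx.
- by rewrite /upd2 !eqxx.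
- by rewrite /upd2 !eqxx.
- by move=> j y yx; rewrite /upd2 (negPf yx) !andbF.
Qed.

Lemma wp_check_wrap done (u v : nat) z1 z2 z3 (Q : vpred) V s A :
  (u, v, [:: z1; z2; z3]) \in ps ->
  production_read done (u, v, [:: z1; z2; z3]) V A ->
  (forall V' A', production_checked done (u, v, [:: z1; z2; z3]) V' A' -> Q V' s A') ->
  wp check_wrap Q V (symbol_code z1 ++ symbol_code z2 ++ symbol_code z3 ++ s)
    (upd2 A MARK (pair_index (u, v)) 1).
Proof.
move=> pps [gV inv nd [/= Vu Vv Va] [Vi Vk]] HQ.
have form := answer_form pps; have [[/= un vn] small] := production_small pps.
have /= E0 := gV 0 isT; have /= E1 := gV 1 isT; have /= En := gV 4 isT.
have /= E2 := gV 2 isT; have /= E3 := gV 3 isT.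
have xm := pair_index_small (a := (u, v)) un vn.
case: z1 pps inv nd HQ form small => [[x1 y1]|[x1 y1]] pps inv nd HQ form small.
  apply: wp_seq; apply: wp_next; apply: wp_seq; apply: wp_require_eq; rewrite /= E1 //.
  by move=> _ /form/walk_productionP[? [? []]].
apply: wp_seq; apply: wp_next; apply: wp_seq; apply: wp_require_eq; rewrite /= E1 // => _.
do 2 (apply: wp_seq; apply: wp_next).
case: z2 pps inv nd HQ form small => [[x2 y2]|[x2 y2]] pps inv nd HQ form small; last first.
  apply: wp_seq; apply: wp_next; apply: wp_seq; apply: wp_require_eq; rewrite /= E0 //.
  by move=> _ /form/walk_productionP[? [? []]].
have /= [x2n y2n] : (x2, y2).1 < n /\ (x2, y2).2 < n by apply: small; rewrite !inE eqxx orbT.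
apply: wp_seq; apply: wp_next; apply: wp_seq; apply: wp_require_eq; rewrite /= E0 // => _.
do 2 (apply: wp_seq; apply: wp_next).
case: z3 pps inv nd HQ form small => [[x3 y3]|[x3 y3]] pps inv nd HQ form small.
  apply: wp_seq; apply: wp_next; apply: wp_seq; apply: wp_require_eq; rewrite /= E1 //.
  by move=> _ /form/walk_productionP[? [? []]].
apply: wp_seq; apply: wp_next; apply: wp_seq; apply: wp_require_eq; rewrite /= E1 // => _.
do 2 (apply: wp_seq; apply: wp_next).
apply: wp_seq; apply: wp_require_eq; rewrite /= ?Vu => e1.
  by move=> /form/walk_productionP[? [? [[? ?] [? ?] [? ?] _]]]; subst.
apply: wp_seq; apply: wp_require_eq => /= e2.
  by move=> /form/walk_productionP[? [? [[? ?] [? ?] [? ?] _]]]; subst.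
apply: wp_seq; apply: wp_require_eq => /= e3.
  by move=> /form/walk_productionP[? [? [[? ?] [? ?] [? ?] _]]]; subst.
apply: wp_seq; apply: wp_require_eq; rewrite /= ?Vv => e4.
  by move=> /form/walk_productionP[? [? [[? ?] [? ?] [? ?] _]]]; subst.
subst x1 y1 x3 y3.
have {}form : answer -> [/\ (u, x2) \in edges I, (y2, v) \in edges I &
    [:: label I (u, x2); label I (y2, v)] = [:: LPar; RPar] \/
    [:: label I (u, x2); label I (y2, v)] = [:: LBra; RBra]].
  by move=> /form/walk_productionP[x [y [/= [ex] [_ ey] _ H]]]; subst x y.
have i2m := pair_index_small (a := (x2, y2)) x2n y2n.
apply: wp_seq; apply: wp_edge_code => //=; first by do !apply: glob_upd.
apply: wp_seq; apply: wp_edge_code => //=; first by do !apply: glob_upd.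
apply: wp_seq; apply: wp_require_le; rewrite /= E1 => c1.
  by move=> /form[uI _ _]; move: c1; rewrite ltnNge edge_code_gt0 uI.
have c1le : edge_code (u, x2) <= 4 by rewrite /edge_code; case: ifP => //; case: label.
apply: wp_seq; apply: wp_add; rewrite /= E1; first exact: small_fits.
apply: wp_seq; apply: wp_require_eq => /= c2.
  move=> /form[uI vI lab]; apply: c2; rewrite /edge_code uI vI.
  by case: lab => [[-> ->]|[-> ->]].
(* Consecutive positive codes are [1, 2], [3, 4] or [2, 3]. Only the last pair does not match; the
   remaining test excludes it. *)
have wI : walk_production I (u, v) [:: inr (u, x2); inl (x2, y2); inr (y2, v)] \/
    edge_code (u, x2) = 2.
  move: c1 c2; rewrite /edge_code.
  case: ifP => // uI _; case: ifP => [vI|_]; last by rewrite addn1.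
  case lu: (label I (u, x2)); case lv: (label I (y2, v)) => //= _; try by right.
  - by left; constructor; rewrite ?lu ?lv //; left.
  - by left; constructor; rewrite ?lu ?lv //; right.
pose Q' := wp (idx vx vx2 vy2 ;; incr vx ;; store SUCC1 va vx) Q.
have fin V' : glob V' -> V' vx2 = x2 -> V' vy2 = y2 -> V' va = pair_index (u, v) ->
    V' vi = size done -> V' vk = size ps ->
    walk_production I (u, v) [:: inr (u, x2); inl (x2, y2); inr (y2, v)] ->
    Q' V' s (upd2 A MARK (pair_index (u, v)) 1).
  move=> gV' Vx2 Vy2 Va' Vi' Vk' wpr; have /= E1' := gV' 1 isT.
  apply: wp_seq; apply: wp_pair_index => //=; rewrite ?Vx2 ?Vy2 //.
  apply: wp_seq; apply: wp_add; rewrite /= E1'; first exact: ltn_fits.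
  apply: wp_store => //=; first by rewrite Va'.
  rewrite Va' addn1; apply: HQ; split=> //; first by do !apply: glob_upd.
  have [_ S2] := marked_inv (p := ((u, v), _)) inv xm nd.
  apply: (productions_inv_rcons inv nd) => //=.
  - by rewrite /upd2 !eqxx.
  - by rewrite /upd2 !eqxx.
  - by move=> j y yx; rewrite /upd2 (negPf yx) !andbF.
apply: wp_seq; apply: wp_if; rewrite /= E2 => c3.
  apply: wp_skip; apply: fin => //; first by do !apply: glob_upd.
  by case: wI => // e; move: c3; rewrite e.
apply: wp_require_lt; rewrite /= E3 => c4.
  move=> /form[uI _ lab]; move: c3 c4; rewrite /edge_code uI.
  by case: lab => [[-> _]|[-> _]].
apply: fin => //; first by do !apply: glob_upd.
by case: wI => // e; move: c4; rewrite e.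
Qed.

Lemma wp_check_production done p todo (Q : vpred) V s A : ps = done ++ p :: todo ->
  glob V -> V vi = size done -> V vk = size ps -> size ps <= m ->
  productions_inv done A ->
  (forall V' A', glob V' -> V' vi = (size done).+1 -> V' vk = size ps ->
     productions_inv (rcons done p) A' -> Q V' s A') ->
  wp check_production Q V (production_code p ++ s) A.
Proof.
case: p => [[u v] rhs] eps gV Vi Vk szm inv HQ.
have pps : (u, v, rhs) \in ps by rewrite eps mem_cat mem_head orbT.
have [[/= un vn] _] := production_small pps; have form := answer_form pps.
have /= E0 := gV 0 isT; have /= E1 := gV 1 isT.
have /= E2 := gV 2 isT; have /= E3 := gV 3 isT.
have xm := pair_index_small (a := (u, v)) un vn.
do 2 (apply: wp_seq; apply: wp_next).
apply: wp_seq; apply: wp_pair_index => //=; first by do !apply: glob_upd.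
apply: wp_seq; apply: wp_load => //=; rewrite (pi_mark inv) //.
apply: wp_seq; apply: wp_require_le; rewrite /= E0; case: (boolP (_ \in _)) => // nd _.
  (* A marked cell stems from an earlier production [q] with the same left-hand side. In a walk
     scheme [q] would be the current production, which [ps] lists only once. *)
  move=> ans; have /mapP[q qd eq] := nd.
  have qps : q \in ps by rewrite eps mem_cat qd.
  have [[_ qn] _] := production_small qps.
  have ep := answer_lhs_inj ans pps qps (pair_index_inj (a := (u, v)) vn qn eq).
  have : uniq ps by rewrite (perm_uniq psE) fset_uniq.
  by rewrite eps cat_uniq ep /= qd /= andbF.
apply: wp_seq; apply: wp_store => //=; rewrite E1.
apply: wp_seq; apply: wp_next.
set V1 := upd _ vl _.
have rd : production_read done (u, v, rhs) V1 A.
  by split=> //; do !apply: glob_upd.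
have fin V' A' : production_checked done (u, v, rhs) V' A' -> wp (incr vi) Q V' s A'.
  case=> gV' inv' [Vi' Vk']; have /= E1' := gV' 1 isT.
  have sd : size done < m by apply: leq_trans szm; rewrite eps size_cat /= addnS ltnS leq_addr.
  apply: wp_add; rewrite /= Vi' E1'; first exact: ltn_fits.
  by apply: HQ => //=; rewrite ?addn1 //; apply: glob_upd.
have [Vl F0 F2 F3] : [/\ V1 vl = size rhs, V1 0 = 0, V1 2 = 2 & V1 3 = 3] by [].
have [gV1 _ _ [/= Vu1 Vv1 _] [Vi1 Vk1]] := rd; clearbody V1.
apply: wp_seq; apply: wp_if; rewrite F0 Vl => l0; last first.
  apply: wp_if; rewrite F2 Vl => l2.
    apply: wp_seq; apply: wp_require_eq; rewrite F2 Vl => el.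
      by move=> /form/walk_productionP; case: (rhs) el l0 l2 => [|z1 [|z2 [|z3 r]]].
    have [z1 [z2 er]] : exists z1 z2, rhs = [:: z1; z2].
      by case: (rhs) el => [|z1 [|z2 [|z3 r]]] // _; exists z1, z2.
    subst rhs; rewrite /= cats0 -catA.
    exact: wp_check_concat pps rd fin.
  apply: wp_seq; apply: wp_require_eq; rewrite F3 Vl => el.
    by move=> /form/walk_productionP; case: (rhs) el l2 => [|z1 [|z2 [|z3 [|z4 r]]]].
  have [z1 [z2 [z3 er]]] : exists z1 z2 z3, rhs = [:: z1; z2; z3].
    by case: (rhs) el => [|z1 [|z2 [|z3 [|z4 r]]]] // _; exists z1, z2, z3.
  subst rhs; rewrite /= cats0 -!catA.
  exact: wp_check_wrap pps rd fin.
have er : rhs = [::] by case: (rhs) l0.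
subst rhs; apply: wp_require_eq; rewrite Vu1 Vv1 => euv.
  by move=> /form/walk_productionP.
apply: fin; split=> //.
have [S1 S2] := marked_inv (p := ((u, v), [::])) inv xm nd.
apply: (productions_inv_rcons (p := ((u, v), [::])) inv nd) => //=.
- by rewrite -euv; constructor; rewrite vertexE.
- by rewrite /upd2 !eqxx.
- by move=> j y yx; rewrite /upd2 (negPf yx) !andbF.
Qed.

Definition succ1 x := nth 0 (successors ps x) 0.
Definition succ2 x := nth 0 (successors ps x) 1.

Lemma wp_check_productions (Q : vpred) V A : glob V -> V vc = size ns ->
  size ns <= m -> (forall j x, A j x = 0) ->
  (forall V' A', glob V' -> productions_inv ps A' -> size ps = size ns -> Q V' [::] A') ->
  wp check_productions Q V ps_input A.
Proof.
move=> gV Vc szm A0 HQ; apply: wp_seq; apply: wp_next.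
apply: wp_seq; apply: wp_require_eq => /=; rewrite Vc => se.
  (* In a walk scheme, taking left-hand sides is a bijection from productions to nonterminals, so
     different counts justify rejection. *)
  move=> ans; apply: se; rewrite -(size_map fst).
  apply/perm_size/uniq_perm; last 1 first.
  - move=> a; rewrite -nonterminalsE; apply/mapP/idP => [[p]|ag].
      by rewrite (perm_mem psE) => /lhs_nonterminal ? ->.
    have [_ _ _ un _ _] := ans; have [rhs [rg _]] := un _ ag.
    by exists (a, rhs); rewrite ?(perm_mem psE).
  - rewrite map_inj_in_uniq ?(perm_uniq psE) ?fset_uniq // => p q pps qps.
    exact: answer_lhs_inj.
  - by rewrite (perm_uniq nsE) fset_uniq.
apply: wp_seq; apply: wp_cst => //; rewrite -[flatten _]cats0.
apply: (wp_scan (Inv := fun done V A =>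
  [/\ glob V, V vi = size done, V vk = size ps & productions_inv done A])).
- by rewrite se.
- by move=> done V' A' [_ -> ->].
- move=> done p todo V' A' e [gV' Vi Vk inv] s.
  apply: (wp_check_production e) => //; first by rewrite se.
  by move=> V2 A2 gV2 Vi2 Vk2 inv2; rewrite size_rcons.
- by move=> V' A' [gV' _ _ inv]; apply: HQ.
- by split=> //; do !apply: glob_upd.
Qed.

Lemma successorsP x y : reflect
  (exists2 p, p \in ps & pair_index p.1 = x /\ exists2 b, inl b \in p.2 & (pair_index b).+1 = y)
  (y \in successors ps x).
Proof.
apply: (iffP flattenP) => [[l /mapP[p]]|[p pps [px [b bp by_]]]].
  rewrite mem_filter => /andP[/eqP px pps] -> /mapP[b bp ->].
  by exists p => //; split=> //; exists b; rewrite -?mem_rhs_nonterminals.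
exists [seq (pair_index b).+1 | b <- rhs_nonterminals p.2].
  by apply: map_f; rewrite mem_filter px eqxx.
by rewrite -by_; apply: map_f; rewrite mem_rhs_nonterminals.
Qed.

Hypothesis ps_form : forall p, p \in ps -> walk_production I p.1 p.2.
Hypothesis ps_uniq : uniq (lhs_indices ps).

Lemma successors_small x y : y \in successors ps x -> y <= m.
Proof.
move=> /successorsP[p pps [_ [b bp <-]]].
by have [_ /(_ _ bp)[b1 b2]] := production_small pps; apply: pair_index_small.
Qed.

(** By [ps_uniq] at most one production contributes, and a walk production has at most two
    nonterminals on its right. *)
Lemma size_successors x : size (successors ps x) <= 2.
Proof.
rewrite /successors; elim: (ps) ps_uniq ps_form => [//|p l IH] /= /andP[pl ul] form.
case: eqP => [px|_]; last by apply: IH => // q ql; apply: form; rewrite inE ql orbT.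
rewrite /= -/(successors l x) successors_nil -?px // cats0 size_map.
by have := form p (mem_head _ _); case: p {pl form px} => a rhs /=; case.
Qed.

Lemma mem_successors x y : (y.+1 \in successors ps x) = (y.+1 \in [:: succ1 x; succ2 x]).
Proof.
rewrite /succ1 /succ2; have := size_successors x.
by case: (successors ps x) => [|a [|b []]] //= _; rewrite !inE ?orbF.
Qed.

Lemma succ_small x : succ1 x <= m /\ succ2 x <= m.
Proof.
rewrite /succ1 /succ2; have := @successors_small x.
case: (successors ps x) => [|a [|b l]] H //=; split=> //; apply: H; rewrite !inE eqxx ?orbT //.
Qed.

(** [pair_index] and division with remainder are homomorphisms in the two directions; pairs related
    by [occurs] have entries below [n], where the two maps are inverse to each other. *)
Lemma acyclic_succ_rel : acyclic (succ_rel n succ1 succ2) <-> acyclic (occurs g).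
Proof.
split; last first.
  apply: (acyclic_homo (f := fun x => (x %/ n, x %% n))) => x y.
  rewrite /succ_rel -mem_successors => /andP[_ /successorsP[p pps [<- [b bp [<-]]]]].
  have [[p1 p2] /(_ _ bp)[b1 b2]] := production_small pps.
  rewrite /pair_index !divnMDl ?n_gt0 // !divn_small // !addn0 !modnMDl !modn_small //.
  apply/hasP; exists p; first by rewrite -(perm_mem psE).
  by case: p.1 b bp {p1 p2 b1 b2} => ? ? [? ?] /= ->; rewrite eqxx.
apply: (acyclic_homo (f := pair_index)) => a b /hasP[p pg /andP[/eqP <- bp]].
have pps : p \in ps by rewrite (perm_mem psE).
have [[p1 p2] _] := production_small pps.
rewrite /succ_rel pair_index_small // -mem_successors.
by apply/successorsP; exists p => //; split=> //; exists b.
Qed.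

Hypotheses (terms : terminals g = edges I) (ax : axiom g = (source I, target I))
  (ps_size : size ps = size ns).

Lemma checked_walk_scheme : acyclic (occurs g) -> answer.
Proof.
move=> acy; split=> //.
- apply/fsubsetP => a; rewrite nonterminalsE in_fsetM !vertexE => /ns_small[-> ->] //.
- have up : uniq (map fst ps) by apply: (@map_uniq _ _ pair_index); rewrite -map_comp.
  have sub : {subset map fst ps <= ns}.
    by move=> a /mapP[p]; rewrite (perm_mem psE) -nonterminalsE => /lhs_nonterminal ? ->.
  have [|_ psns] := uniq_min_size up sub; first by rewrite size_map ps_size.
  move=> a; rewrite nonterminalsE -psns => /mapP[[c rhs] pps ->]; exists rhs.
  split=> [|rhs'] /=; rewrite -(perm_mem psE) // => pps'.
  by have [] := uniq_map_inj up pps pps' erefl.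
- by move=> a rhs; rewrite -(perm_mem psE) => /ps_form.
Qed.

End Checker.

(** * The complete program and its running time *)

Definition prologue : program :=
  [:: Const 2 1; Read 3 1; Mul 3 3 3; Add 4 0 1; Add 5 4 3; Add 6 5 3;
      Add 7 6 3; Add 8 7 3].

Definition checker_program : program := prologue ++ compile 8 checker.

Lemma exec_small w i c : (forall r, reg c r < 2 ^ w) ->
  forall r, reg (exec w i c) r < 2 ^ w.
Proof.
have W0 : 0 < 2 ^ w by rewrite expn_gt0.
by case: c => k R M Rs; case: i => //= *; case: eqP => // _; rewrite ltn_pmod.
Qed.

Lemma execs_small w l c : (forall r, reg c r < 2 ^ w) ->
  forall r, reg (execs w c l) r < 2 ^ w.
Proof. by elim: l c => //= i l IH c Rs; apply/IH/exec_small. Qed.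

(** Register 1 is still [0], so [Read 3 1] fetches [n] and [Add 4 0 1] copies the input length; the
    other bases follow at distance [n * n]. *)
Lemma rep_prologue w n input : nth 0 input 0 = n -> n * n + 3 <= size input ->
  8 * (size input).+1 <= 2 ^ w -> all (fun x => x < 2 ^ w) input ->
  let c := execs w (init input) prologue in
  rep w input n (reg c) (memory c) (fun=> 0) input (fun _ _ => 0).
Proof.
move=> e0 N_large W_large small.
have W0 : 0 < 2 ^ w by rewrite expn_gt0.
have Rs : forall r, reg (execs w (init input) prologue) r < 2 ^ w.
  by apply: execs_small => r /=; case: eqP => // _; lia.
split=> //=; rewrite ?drop0 //.
- by rewrite modn_small; lia.
(* The largest base is [N + 4 * (n * n) <= 5 * N], with [N] the input length. *)
- have sm x : x <= 5 * size input -> x %% 2 ^ w = x by move=> le; rewrite modn_small; lia.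
  have nm : n <= n * n by nia.
  rewrite e0 addn0 (sm n); last lia.
  rewrite (sm (n * n)); last lia.
  by case=> [|[|[|[|[|//]]]]] /= _; rewrite !sm; lia.
- by move=> j i _ im; rewrite nth_default //; lia.
- move=> x; case: (ltnP x (size input)) => xN; last by rewrite nth_default.
  exact: (all_nthP 0 small).
Qed.

(** [Q] is arbitrary because every run ends in a [Stop]. The facts established by the passed checks
    combine to [walk_scheme] at the final [Stop true]. *)
Lemma wp_checker (I : dyck_instance nat) (g : pair_cfg nat) w n ts ns ps (Q : vpred) V :
  vertices I =i iota 0 n -> perm_eq ts (terminals g) -> perm_eq ns (nonterminals g) ->
  perm_eq ps (productions g) ->
  wp w (whole_input I g n ts ns ps) n (walk_scheme I g) checker Q V
    (whole_input I g n ts ns ps) (fun _ _ => 0).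
Proof.
move=> VE tsE nsE psE.
apply: wp_seq; apply: wp_setup => {}V gV.
apply: wp_seq; apply: wp_count_edges => // {gV}V gV Vc.
apply: wp_seq; apply: wp_check_terminals => // {gV Vc}V gV termsE.
apply: wp_seq; apply: wp_check_nonterminals => // {gV}V gV Vc szm ns_small.
apply: wp_seq; apply: wp_check_axiom => // {gV Vc}V gV Vc axE.
apply: wp_seq; apply: wp_check_productions => // {gV Vc}V A gV inv psz.
pose f1 := succ1 n ps; pose f2 := succ2 n ps.
have form := pi_form inv; have up := pi_uniq inv.
have f1m x : x < n * n -> f1 x <= n * n.
  by move=> _; have [] := succ_small tsE nsE psE ns_small x.
have f2m x : x < n * n -> f2 x <= n * n.
  by move=> _; have [] := succ_small tsE nsE psE ns_small x.
have acyE := acyclic_succ_rel VE tsE nsE psE ns_small form up.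
have ans_acy : walk_scheme I g -> acyclic (succ_rel n f1 f2).
  by case=> _ _ _ _ _ /acyE.
have sA : succs_stored n f1 f2 A.
  by move=> x xm; rewrite (pi_succ1 inv) ?(pi_succ2 inv).
apply: wp_seq; apply: (wp_count_degrees f1m f2m gV sA (pi_deg inv)) => {gV sA inv}V {}A gV sA D.
apply: wp_seq; apply: (wp_init_queue (d := fun b => A DEG b) gV sA) => // {gV sA}V B gV sB DB qB.
apply: wp_seq; apply: (wp_kahn f1m f2m ans_acy gV sB) => [b||V1 C acy].
- by rewrite DB D.
- by under eq_filter do rewrite DB.
apply: wp_stop; split=> // _.
exact: (checked_walk_scheme VE nsE psE ns_small form up termsE axE psz (proj1 acyE acy)).
Qed.

(** Without nested loops the cost is affine in [m]; [8] is the length of the prologue and [1000] a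
    generous round bound. *)
Lemma cost_checker m : 0 < m -> 8 + cost m checker <= 1000 * m.
Proof.
move=> m0; rewrite /checker /setup /count_edges /check_terminals /check_nonterminals.
rewrite /check_axiom /check_productions /check_production /check_concat /check_wrap.
rewrite /count_degrees /init_queue /kahn /bump /relax /=; lia.
Qed.

(** One multiple of the bit length accommodates [(size input).+1]; three more supply the three bits
    for the factor [8], whence the bound [4] on [d]. *)
Lemma word_size_large d (input : seq nat) : 4 <= d ->
  8 * (size input).+1 <= 2 ^ word_size d input.
Proof.
move=> d4; apply: (@leq_trans (2 ^ (3 + (trunc_log 2 (size input)).+1))).
  by rewrite expnD leq_mul2l /= trunc_log_ltn.
by rewrite leq_exp2l // /word_size; nia.
Qed.

Theorem theorem5 :
  (forall (K : choiceType) (I : dyck_instance K),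
     yes_instance I <-> exists g : pair_cfg K, walk_scheme I g) /\
  ram_decidable_in_O encodes
    (fun x : dyck_instance nat * pair_cfg nat => walk_scheme x.1 x.2)
    (fun x : dyck_instance nat * pair_cfg nat => #|` vertices x.1| ^ 2).
Proof.
split=> [K I|]; first exact: yes_instanceP.
exists checker_program, 4, 1000 => d [I g] input d4 [/= VE [ts [ns [ps [tsE nsE psE inE]]]]].
set n := #|` vertices I| in VE inE *; move=> small.
have {}inE : input = whole_input I g n ts ns ps by [].
have N_large : n * n + 3 <= size input.
  by rewrite inE /whole_input !size_cat size_allpairs !size_iota /=; lia.
have W_large := word_size_large input d4.
have e0 : nth 0 input 0 = n by rewrite inE.
have rp := rep_prologue e0 N_large W_large small.
move: (word_size d input) W_large small rp => w W_large small rp.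
suff : good w (walk_scheme I g) checker_program (1000 * n ^ 2) (init input) by [].
have n0 : 0 < n * n by rewrite muln_gt0 (n_gt0 VE).
rewrite -mulnn; apply: (good_mono (cost_checker n0)).
apply: (good_raw (l := prologue)) => //; first by do 8 (case=> [//|]).
rewrite (execs_pc w 0) // -[X in good _ _ _ X _]addn0.
rewrite inE in rp *.
apply: (wp_checker (Q := fun _ _ _ => False) VE tsE nsE psE) rp _ => //.
Qed.
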